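(* Let $\mathbb{K}$ be an algebraically closed field. For $0\le t\le 4$, let $S_t\subset\mathbb{P}^{9-t}$ be the smooth del Pezzo surface obtained as the inner projection of the triple Veronese surface $\nu_3(\mathbb{P}^2)\subset\mathbb{P}^9$ from the points $\nu_3(p)$, $p\in\Sigma$, where $\Sigma\subset\mathbb{P}^2$ is a set of $t$ points in linearly general position (so $S_0=\nu_3(\mathbb{P}^2)$). Let $S_5\subset\mathbb{P}^8$ be the $2$-uple Veronese embedding of the smooth quadric surface in $\mathbb{P}^3$. Then $$\text{rank-index}(S_t)=\begin{cases}3 & \text{if } t=0,5,\\ 4 & \text{if } t=1,2,3,4.\end{cases}$$
   Context: $\nu_d$ denotes the $d$-uple Veronese embedding. The inner projection of $\nu_3(\mathbb{P}^2)$ from the points $\nu_3(p)$, $p\in\Sigma$, is the closure of its image under the linear projection from the linear span of these points; equivalently, $S_t$ is the closure of the image of $\mathbb{P}^2$ under the rational map given by the linear system of plane cubics through $\Sigma$. Linearly general position of the $t\le4$ points means that they are distinct and no three are collinear. The surface $S_5$ is the image of the smooth quadric $V(x_0x_3-x_1x_2)\subset\mathbb{P}^3$ under $\nu_2:\mathbb{P}^3\to\mathbb{P}^9$, regarded in its linear span $\mathbb{P}^8$. The homogeneous ideals of all these surfaces are generated by quadratic forms. The rank of a quadratic form is the rank of its associated symmetric matrix. $\text{rank-index}(X)$ is the smallest integer $k$ such that the homogeneous ideal $I(X)$ can be generated by quadratic forms of rank at most $k$.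
   Formalization: The field is assumed to have characteristic different from 2, since in characteristic 2 a quadratic form with cross terms (such as xy − zw) has no associated symmetric matrix and its rank is undefined. *)

(* Defs.v *)
From HB Require Import structures.
From mathcomp Require Import all_boot all_algebra.
From mathcomp Require Import mpoly.

Set Implicit Arguments.
Unset Strict Implicit.
Unset Printing Implicit Defensive.

Import GRing.Theory.
Local Open Scope ring_scope.

(* A subset of P^(n-1) is given by the homogeneous coordinate vectors of its
   points; the zero vector never represents a point. *)
Definition pset (K : closedFieldType) (n : nat) := 'rV[K]_n -> Prop.

Definition pspace (K : closedFieldType) (n : nat) : pset K n :=
  fun x => x != 0.

Definition hypersurface (K : closedFieldType) (n : nat) (f : {mpoly K[n]}) :
  pset K n := fun x => x != 0 /\ f.@[x 0] = 0.

(* The homogeneous ideal I(X): all the homogeneous components of f vanish at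
   every point of X. *)
Definition in_hideal (K : closedFieldType) (n : nat) (X : pset K n)
    (f : {mpoly K[n]}) : Prop :=
  forall (d : nat) (x : 'rV[K]_n),
    x != 0 -> X x -> (pihomog mdeg d f).@[x 0] = 0.

Definition zariski_closure (K : closedFieldType) (n : nat) (X : pset K n) :
  pset K n :=
  fun x => x != 0 /\ forall f : {mpoly K[n]}, in_hideal X f -> f.@[x 0] = 0.

(* The set-theoretic image of X under the rational map [x] |-> [F x], which is
   undefined at the points where F x = 0. *)
Definition pimage (K : closedFieldType) (m n : nat)
    (F : 'rV[K]_m -> 'rV[K]_n) (X : pset K m) : pset K n :=
  fun y => y != 0 /\
    exists (x : 'rV[K]_m) (c : K), [/\ x != 0, X x, c != 0 & y = c *: F x].

(* nu_d on P^n; basis n.+1 d is the set of nondecreasing d-tuples of indices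
   i_1 <= ... <= i_d, i.e. of degree d monomials x_(i_1) ... x_(i_d). *)
Definition veronese (K : closedFieldType) (n d : nat) (x : 'rV[K]_n.+1) :
    'rV[K]_#|basis n.+1 d| :=
  \row_k \prod_(i <- (enum_val k : d.-tuple 'I_n.+1)) x 0 i.

(* The columns of M are the coordinates of a linear projection onto P^(r-1)
   whose center is the span of the rows of C. *)
Definition projection_from (K : closedFieldType) (s n r : nat)
    (C : 'M[K]_(s, n)) (M : 'M[K]_(n, r)) : Prop :=
  row_full M /\ (kermx M :=: C)%MS.

Definition linear_projection (K : closedFieldType) (n r : nat) (X : pset K n)
    (M : 'M[K]_(n, r)) : pset K r :=
  zariski_closure (pimage (fun x => x *m M) X).

(* The rows of B are a basis of the linear span of X. *)
Definition basis_of_span (K : closedFieldType) (n r : nat) (X : pset K n)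
    (B : 'M[K]_(r, n)) : Prop :=
  row_free B /\
  forall W : 'M[K]_n, (B <= W)%MS <-> (forall x, X x -> (x <= W)%MS).

(* X seen inside its span, in the coordinates given by the rows of B. *)
Definition in_span (K : closedFieldType) (n r : nat) (X : pset K n)
    (B : 'M[K]_(r, n)) : pset K r :=
  fun y => y != 0 /\ X (y *m B).

Definition linearly_general (K : closedFieldType) (t : nat)
    (p : 'I_t -> 'rV[K]_3) : Prop :=
  [/\ forall i, p i != 0,
      forall i j, i != j -> ~~ (p i == p j)%MS
    & forall i j k, i != j -> i != k -> j != k ->
        forall l : 'cV[K]_3, p i *m l = 0 -> p j *m l = 0 -> p k *m l = 0 ->
        l = 0].

(* q has an associated symmetric matrix of rank at most k; that matrix exists
   and is unique for every quadratic form q when 2 is invertible in K. *)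
Definition quadric_rank_le (K : closedFieldType) (n k : nat)
    (q : {mpoly K[n]}) : Prop :=
  exists A : 'M[K]_n,
    [/\ A^T = A, q = \sum_i \sum_j A i j *: ('X_i * 'X_j) & (\rank A <= k)%N].

Definition ideal_gen (K : closedFieldType) (n : nat) (G : {mpoly K[n]} -> Prop)
    (f : {mpoly K[n]}) : Prop :=
  exists s : seq ({mpoly K[n]} * {mpoly K[n]}),
    (forall u, u \in s -> G u.2) /\ f = \sum_(u <- s) u.1 * u.2.

Definition generated_in_rank (K : closedFieldType) (n : nat) (X : pset K n)
    (k : nat) : Prop :=
  exists G : {mpoly K[n]} -> Prop,
    (forall q, G q -> quadric_rank_le k q) /\
    (forall f, in_hideal X f <-> ideal_gen G f).

Definition rank_index (K : closedFieldType) (n : nat) (X : pset K n)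
    (k : nat) : Prop :=
  generated_in_rank X k /\ forall j, generated_in_rank X j -> (k <= j)%N.

Definition veronese_plane (K : closedFieldType) : pset K #|basis 3 3| :=
  pimage (@veronese K 2 3) (@pspace K 3).

Definition quadric_surface (K : closedFieldType) : pset K 4 :=
  hypersurface ('X_(inord 0) * 'X_(inord 3) - 'X_(inord 1) * 'X_(inord 2)).

Definition veronese_quadric (K : closedFieldType) : pset K #|basis 4 2| :=
  pimage (@veronese K 3 2) (@quadric_surface K).

(* Main.v *)
Require Import Defs.
From HB Require Import structures.
From mathcomp Require Import all_boot all_algebra zify ring.
From mathcomp Require Import mpoly.
Set Implicit Arguments.
Unset Strict Implicit.
Unset Printing Implicit Defensive.
Import GRing.Theory.
Local Open Scope ring_scope.

(* In coordinates where the points are (1:0:0), (0:1:0), (0:0:1), (1:1:1), the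
   ideal of the surface is the kernel of [y_j |-> G_j(x)], the [G_j] being
   monomials (a lattice polygon) except for t = 4, where their leading monomials
   form a pentagon of normalized area 5.  Fix a unimodular triangulation of the
   polygon.  Kernel quadrics of rank at most 4 (binomials [y_i y_j - y_k y_l] in
   the monomial case) rewrite every monomial into monomials supported on cells
   of the triangulation; those have distinct leading weights, hence
   independent images, so these quadrics generate the kernel.  For t = 0 and for
   the quadric surface the binomials are combinations of quadrics
   [ab - c^2] of the kernel by polarization, so rank 3 suffices.

   Conversely, let the symmetric matrix A define a kernel quadric.  For t >= 1,
   let a, b, c, d be the coefficient vectors of x^2 y, x^2 z, x y^2, xyz in the
   parametrization (x^3 is missing).  The coefficients of x^4 y^2, x^4 yz, x^4 z^2,
   x^3 y^3, x^3 y^2 z give A(a,a) = A(a,b) = A(b,b) = A(a,c) = A(a,d) + A(b,c) = 0.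
   When rank A <= 3 the isotropic pair a, b is dependent modulo the radical, and
   then A(b,c) = 0; but some kernel quadric has A(b,c) <> 0.  The same argument
   with x^3, x^2 y, x y^2 excludes rank 2 in the remaining two cases. *)

(** * Polynomials and quadratic forms *)

Lemma closed_poly_eq0 (K : closedFieldType) (p : {poly K}) :
  (forall x, p.[x] = 0) -> p = 0.
Proof.
move=> p0; apply/eqP; case: (p =P 0) => // /eqP /closed_nonrootP [x].
by rewrite /root p0 eqxx.
Qed.

Lemma closed_coef_eq0 (K : closedFieldType) (n : nat) (c : nat -> K) :
  (forall x, \sum_(k < n) c k * x ^+ k = 0) -> forall k, (k < n)%N -> c k = 0.
Proof.
move=> c0 k ltkn; have p0: \poly_(k < n) c k = 0.
  by apply: closed_poly_eq0 => x; rewrite horner_poly c0.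
by have := coef_poly n c k; rewrite p0 coef0 ltkn.
Qed.

(** The lowest digit is the residue modulo [N], and the rest follows by induction. This makes
    Kronecker substitution injective on monomials. *)
Lemma base_expansion_inj (N n : nat) (a b : nat -> nat) :
  (forall i, (i < n)%N -> (a i < N)%N) -> (forall i, (i < n)%N -> (b i < N)%N) ->
  (\sum_(i < n) a i * N ^ i = \sum_(i < n) b i * N ^ i)%N ->
  forall i, (i < n)%N -> a i = b i.
Proof.
elim: n a b => [//|n IH] a b aN bN; rewrite !big_ord_recl /= !expn0 !muln1.
have shift c : (\sum_(i < n) c (bump 0 i) * N ^ bump 0 i =
                (\sum_(i < n) c i.+1 * N ^ i) * N)%N.
  by rewrite big_distrl; apply: eq_bigr => i _; rewrite /= expnSr mulnA.
rewrite !shift => E.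
have a0 : (a 0 < N)%N by apply: aN.
have b0 : (b 0 < N)%N by apply: bN.
have E0 : a 0%N = b 0%N.
  have := congr1 (modn^~ N) E.
  by rewrite /= addnC modnMDl [in RHS]addnC modnMDl !modn_small.
have {}E : (\sum_(i < n) a i.+1 * N ^ i = \sum_(i < n) b i.+1 * N ^ i)%N.
  move: E; rewrite E0 => /addnI /eqP; rewrite eqn_mul2r => /orP[/eqP N0|/eqP //].
  by rewrite N0 in a0.
case=> [_ //|i ltin]; apply: (IH (fun i => a i.+1) (fun i => b i.+1)) => // j ltj.
  exact: aN.
exact: bN.
Qed.

(* Kronecker substitution [x_i := t ^ (N ^ i)]. *)
Lemma mpoly_fun_eq0 (K : closedFieldType) (n : nat) (f : {mpoly K[n]}) :
  (forall x : 'I_n -> K, f.@[x] = 0) -> f = 0.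
Proof.
move=> f0; set N := msize f.
pose e (m : 'X_{1..n}) := (\sum_(i < n) m i * N ^ i)%N.
have ltN m : m \in msupp f -> forall i : 'I_n, (m i < N)%N.
  move=> mf i; apply: leq_trans (msize_mdeg_lt mf).
  by rewrite ltnS mdegE (bigD1 i) //= leq_addr.
have e_inj m m' : m \in msupp f -> m' \in msupp f -> e m = e m' -> m = m'.
  move=> mf m'f E; apply/mnmP => i.
  (* The exponents are extended by 0 to all naturals, the form needed for comparing digits. *)
  pose a (m : 'X_{1..n}) k := if insub k is Some j then m j else 0%N.
  have aE (m0 : 'X_{1..n}) (j : 'I_n) : a m0 j = m0 j by rewrite /a valK.
  rewrite -!aE; apply: (@base_expansion_inj N n) (ltn_ord i).
  - by move=> k ltk; rewrite -[k]/(val (Ordinal ltk)) aE ltN.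
  - by move=> k ltk; rewrite -[k]/(val (Ordinal ltk)) aE ltN.
  - by under eq_bigr do rewrite aE; under [RHS]eq_bigr do rewrite aE.
pose p : {poly K} := \sum_(m <- msupp f) f@_m *: 'X^(e m).
have p0 : p = 0.
  apply: closed_poly_eq0 => t; rewrite -(f0 (fun i => t ^+ (N ^ i)%N)) mevalE.
  rewrite horner_sum; apply: eq_bigr => m _; rewrite hornerZ hornerXn.
  congr (_ * _); rewrite /e (big_morph _ (exprD t) (expr0 t)).
  by apply: eq_bigr => i _; rewrite -exprM mulnC.
apply/eqP/negPn/negP => /eqP nf0; apply: nf0; apply/mpolyP => m; rewrite mcoeff0.
have [mf|/memN_msupp_eq0 //] := boolP (m \in msupp f).
have := congr1 (fun q : {poly K} => q`_(e m)) p0.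
rewrite coef0 coef_sum (bigD1_seq m) ?msupp_uniq //= coefZ coefXn eqxx mulr1.
rewrite big1_seq ?addr0 // => m' /andP[nm m'f].
rewrite coefZ coefXn; case: eqP => [/e_inj E|]; last by rewrite mulr0.
by rewrite E ?eqxx in nm.
Qed.

Section Quadrics.

Variables (K : closedFieldType) (n : nat).

Definition linform (v : 'rV[K]_n) : {mpoly K[n]} := \sum_i v 0 i *: 'X_i.

Lemma linform_delta i : linform (delta_mx 0 i) = 'X_i.
Proof.
rewrite /linform (bigD1 i) //= big1 ?addr0 ?mxE ?eqxx ?scale1r // => j nji.
by rewrite mxE (negPf nji) andbF scale0r.
Qed.

Lemma linform_is_linear : linear linform.
Proof.
move=> c u v; rewrite /linform scaler_sumr -big_split; apply: eq_bigr => i _.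
by rewrite !mxE scalerDl scalerA.
Qed.

HB.instance Definition _ := GRing.isLinear.Build K _ _ _ linform linform_is_linear.

Lemma linformD u v : linform (u + v) = linform u + linform v.
Proof. exact: linearD. Qed.

Lemma linformB u v : linform (u - v) = linform u - linform v.
Proof. exact: linearB. Qed.

Lemma linformZ c v : linform (c *: v) = c *: linform v.
Proof. exact: linearZ. Qed.

Definition quadform (A : 'M[K]_n) : {mpoly K[n]} :=
  \sum_i \sum_j A i j *: ('X_i * 'X_j).

Lemma quadform_congr (s : nat) (S : 'M[K]_s) (L : 'M[K]_(s, n)) :
  quadform (L^T *m S *m L) =
  \sum_a \sum_b S a b *: (linform (row a L) * linform (row b L)).
Proof.
rewrite /quadform.
transitivity (\sum_a \sum_b \sum_i \sum_j
                 (S a b * L a i * L b j) *: ('X_i * 'X_j : {mpoly K[n]})).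
  under [RHS]eq_bigr => a _ do rewrite exchange_big /=.
  rewrite [RHS]exchange_big /=; apply: eq_bigr => i _.
  under [RHS]eq_bigr => a _ do rewrite exchange_big /=.
  rewrite [RHS]exchange_big /=; apply: eq_bigr => j _.
  rewrite mxE scaler_suml exchange_big /=; apply: eq_bigr => b _.
  rewrite mxE mulr_suml scaler_suml; apply: eq_bigr => a _.
  by rewrite mxE (mulrC (L a i)).
apply: eq_bigr => a _; apply: eq_bigr => b _.
rewrite /linform mulr_suml scaler_sumr; apply: eq_bigr => i _.
rewrite mulr_sumr scaler_sumr; apply: eq_bigr => j _.
by rewrite -scalerAl -scalerAr !scalerA !mxE.
Qed.

(** A quadratic expression in [s] linear forms has the symmetric matrix [L^T S L], which factors
    through dimension [s]. *)
Lemma quadric_rank_congr (s : nat) (S : 'M[K]_s) (L : 'M[K]_(s, n)) :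
  S^T = S -> quadric_rank_le s
    (\sum_a \sum_b S a b *: (linform (row a L) * linform (row b L))).
Proof.
move=> symS; exists (L^T *m S *m L); split; first by rewrite !trmx_mul trmxK symS mulmxA.
  by rewrite -quadform_congr.
by apply: leq_trans (mxrankM_maxr _ _) _; exact: rank_leq_row.
Qed.

Hypothesis char_neq2 : 2%:R != 0 :> K.

Lemma quadric_rank4 (a b c d : 'rV[K]_n) :
  quadric_rank_le 4 (linform a * linform b - linform c * linform d).
Proof.
pose l : seq 'rV[K]_n := [:: a; b; c; d].
(* Index sum 1 occurs only at the positions of [ab], and index sum 5 only at those of [cd]. *)
pose S : 'M[K]_4 := \matrix_(i, j)
  (if (i + j == 1)%N then 2%:R^-1 else if (i + j == 5)%N then - 2%:R^-1 else 0).
pose L : 'M[K]_(4, n) := \matrix_i l`_i.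
have symS : S^T = S by apply/matrixP => i j; rewrite !mxE addnC.
have -> : linform a * linform b - linform c * linform d =
    \sum_a \sum_b S a b *: (linform (row a L) * linform (row b L)).
  rewrite !big_ord_recl !big_ord0 /= !rowK !mxE /= !scale0r.
  rewrite !add0r !addr0 (mulrC (linform b)) (mulrC (linform d)).
  rewrite !addrA -scalerDl -addrA -scalerDl -opprD.
  suff -> : 2%:R^-1 + 2%:R^-1 = 1 :> K by rewrite scale1r scaleN1r.
  by rewrite -mulr2n -[LHS]mulr_natr mulVf.
exact: quadric_rank_congr.
Qed.

Lemma quadric_rank3 (a b c : 'rV[K]_n) :
  quadric_rank_le 3 (linform a * linform b - linform c ^+ 2).
Proof.
pose l : seq 'rV[K]_n := [:: a; b; c].
(* Index sum 4 occurs only at the diagonal position of [c]. *)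
pose S : 'M[K]_3 := \matrix_(i, j)
  (if (i + j == 1)%N then 2%:R^-1 else if (i + j == 4)%N then - 1 else 0).
pose L : 'M[K]_(3, n) := \matrix_i l`_i.
have symS : S^T = S by apply/matrixP => i j; rewrite !mxE addnC.
have -> : linform a * linform b - linform c ^+ 2 =
    \sum_a \sum_b S a b *: (linform (row a L) * linform (row b L)).
  rewrite !big_ord_recl !big_ord0 /= !rowK !mxE /= !scale0r.
  rewrite !add0r !addr0 (mulrC (linform b)) scaleN1r.
  rewrite !addrA -scalerDl.
  suff -> : 2%:R^-1 + 2%:R^-1 = 1 :> K by rewrite scale1r.
  by rewrite -mulr2n -[LHS]mulr_natr mulVf.
exact: quadric_rank_congr.
Qed.

End Quadrics.

(** * Leading terms and Groebner reduction *)

Section IdealGen.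

Variables (K : closedFieldType) (n : nat) (G : {mpoly K[n]} -> Prop).

Lemma ideal_gen_mem q : G q -> ideal_gen G q.
Proof.
move=> Gq; exists [:: (1, q)]; split; last by rewrite big_seq1 mul1r.
by move=> u; rewrite inE => /eqP ->.
Qed.

Lemma ideal_gen0 : ideal_gen G 0.
Proof. by exists [::]; split => //; rewrite big_nil. Qed.

Lemma ideal_genD p q : ideal_gen G p -> ideal_gen G q -> ideal_gen G (p + q).
Proof.
case=> s [sG ->] [t [tG ->]]; exists (s ++ t); split; last by rewrite big_cat.
by move=> u; rewrite mem_cat => /orP[/sG|/tG].
Qed.

Lemma ideal_genM p q : ideal_gen G q -> ideal_gen G (p * q).
Proof.
case=> s [sG ->]; exists [seq (p * u.1, u.2) | u <- s]; split.
  by move=> u /mapP [v /sG Gv ->].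
by rewrite big_map mulr_sumr; apply: eq_bigr => u _; rewrite mulrA.
Qed.

Lemma ideal_genZ c q : ideal_gen G q -> ideal_gen G (c *: q).
Proof. by move=> Gq; rewrite -mul_mpolyC; exact: ideal_genM. Qed.

Lemma ideal_genN q : ideal_gen G q -> ideal_gen G (- q).
Proof. by rewrite -scaleN1r; exact: ideal_genZ. Qed.

Lemma ideal_genB p q : ideal_gen G p -> ideal_gen G q -> ideal_gen G (p - q).
Proof. by move=> Gp Gq; apply: ideal_genD => //; exact: ideal_genN. Qed.

End IdealGen.

Section LeadingTerms.

Variables (K : closedFieldType) (m r : nat) (om : 'X_{1..m} -> nat).
Hypothesis omD : forall a b, om (a + b)%MM = (om a + om b)%N.

Definition lower (N : nat) (p : {mpoly K[m]}) := forall k, p@_k != 0 -> (om k < N)%N.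

Lemma lower0 N : lower N 0.
Proof. by move=> k; rewrite mcoeff0 eqxx. Qed.

Lemma lowerX k N : (om k < N)%N -> lower N 'X_[k].
Proof. by move=> lt j; rewrite mcoeffX; have [<- //|] := eqVneq k j; rewrite eqxx. Qed.

Lemma lowerD N p q : lower N p -> lower N q -> lower N (p + q).
Proof.
move=> lp lq k; rewrite mcoeffD => nz.
have [p0|nzp] := eqVneq (p@_k) 0; last exact: lp.
by apply: lq; rewrite p0 add0r in nz.
Qed.

Lemma lowerN N p : lower N p -> lower N (- p).
Proof. by move=> lp k; rewrite mcoeffN oppr_eq0; exact: lp. Qed.

(** Two strict bounds add up with a gain of one. This gain absorbs the bound [(om b).+1] of a
    leading monomial in the next product rule. *)
Lemma lowerM a b p q : lower a p -> lower b q -> lower (a + b).-1 (p * q).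
Proof.
move=> lp lq k; rewrite -mcoeff_msupp => /msuppM_le /allpairsP [[u v] /= []].
rewrite !mcoeff_msupp => /lp lu /lq lv ->; rewrite omD; lia.
Qed.

(** The leading coefficient is 1. Since [om] is only a weight, all other terms must be strictly
    lighter; for [om] constantly 0 this says that [p] is the monomial itself. *)
Definition leading (k : 'X_{1..m}) (p : {mpoly K[m]}) := lower (om k) (p - 'X_[k]).

Lemma leadingM a b p q : leading a p -> leading b q -> leading (a + b)%MM (p * q).
Proof.
move=> lp lq; rewrite /leading omD mpolyXD.
have -> : p * q - 'X_[a] * 'X_[b] =
    (p - 'X_[a]) * (q - 'X_[b]) + (p - 'X_[a]) * 'X_[b] + 'X_[a] * (q - 'X_[b]).
  ring.
apply: lowerD; first apply: lowerD.
- by move=> k /(lowerM lp lq); lia.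
- move=> k /(lowerM lp (lowerX (ltnSn (om b)))); lia.
- move=> k /(lowerM (lowerX (ltnSn (om a))) lq); lia.
Qed.

Lemma leading0 : leading 0%MM 1.
Proof. by rewrite /leading mpolyX0 subrr; exact: lower0. Qed.

Lemma leadingX k p i : leading k p -> leading (k *+ i)%MM (p ^+ i).
Proof.
move=> lp; elim: i => [|i IH]; first by rewrite mulm0n expr0; exact: leading0.
by rewrite exprS mulmS; exact: leadingM.
Qed.

Lemma leading_coef k p : leading k p -> p@_k = 1.
Proof.
move=> lp; have [/eqP|/lp] := eqVneq ((p - 'X_[k])@_k) 0; last by rewrite ltnn.
by rewrite mcoeffB mcoeffX eqxx subr_eq0 => /eqP.
Qed.

Lemma leading_coef0 k j p : leading k p -> (om k <= om j)%N -> j != k -> p@_j = 0.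
Proof.
move=> lp le_kj nkj; have [/eqP|/lp] := eqVneq ((p - 'X_[k])@_j) 0.
  by rewrite mcoeffB mcoeffX [k == j]eq_sym (negPf nkj) subr0 => /eqP.
by rewrite ltnNge le_kj.
Qed.

Variables (A : 'I_r -> 'X_{1..m}) (G : r.-tuple {mpoly K[m]}).
Hypothesis leadG : forall j, leading (A j) (tnth G j).

Definition weight (k : 'X_{1..r}) : 'X_{1..m} := (\sum_j A j *+ k j)%MM.

Lemma leading_weight k : leading (weight k) (\prod_j tnth G j ^+ k j).
Proof.
rewrite /weight; elim/big_rec2: _ => [|j p a _ lp]; first exact: leading0.
by apply: leadingM => //; apply: leadingX.
Qed.

Lemma weightE k i : weight k i = (\sum_j A j i * k j)%N.
Proof. by rewrite /weight mnm_sumE; apply: eq_bigr => j _; rewrite mulmnE. Qed.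

(* The leading terms of the images of distinct monomials do not cancel. *)
Lemma leading_independent (f : {mpoly K[r]}) :
  {in msupp f &, injective weight} ->
  (forall x : 'I_m -> K, f.@[fun j => (tnth G j).@[x]] = 0) -> f = 0.
Proof.
move=> inj_w f0; have {}f0 : f \mPo G = 0.
  by apply: mpoly_fun_eq0 => x; rewrite comp_mpoly_meval f0.
apply/eqP; rewrite -msupp_eq0; apply/negPn/negP => nil.
have [k0 k0f] : exists k0, k0 \in msupp f.
  by case: (msupp f) nil => // k0 s _; exists k0; rewrite inE eqxx.
have [k kf kmax] : exists2 k, k \in msupp f &
    forall k', k' \in msupp f -> (om (weight k') <= om (weight k))%N.
  have ex : exists i, has (fun k => om (weight k) == i) (msupp f).
    by exists (om (weight k0)); apply/hasP; exists k0.
  have ub i : has (fun k => om (weight k) == i) (msupp f) ->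
      (i <= \max_(k <- msupp f) om (weight k))%N.
    by case/hasP => k kf /eqP <-; exact: leq_bigmax_seq.
  case: (ex_maxnP ex ub) => i /hasP [k kf /eqP <-] imax.
  by exists k => // k' k'f; apply: imax; apply/hasP; exists k'.
(* By maximality of [k] and injectivity of [weight], no other monomial of [f] contributes to this
   coefficient of the image, which is therefore [f@_k]. *)
have := congr1 (mcoeff (weight k)) f0; rewrite mcoeff0 comp_mpolyEX raddf_sum /=.
rewrite (bigD1_seq k) ?msupp_uniq //= big1_seq ?addr0; last first.
  move=> k' /andP[nk k'f]; rewrite mcoeffZ comp_mpolyX.
  rewrite (leading_coef0 (@leading_weight k')) ?mulr0 ?kmax //.
  by apply: contra nk => /eqP /(inj_w _ _ kf k'f) ->.
rewrite mcoeffZ comp_mpolyX (leading_coef (@leading_weight k)) mulr1 => /eqP.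
by rewrite mcoeff_eq0 kf.
Qed.

(** * Rewriting to normal monomials *)

Variables (normal : rel 'I_r) (mu : 'I_r -> nat) (J : {mpoly K[r]} -> Prop).

(** The support is a clique of [normal]. Powers of a single variable are unrestricted, so only
    products of distinct variables are rewritten. *)
Definition normal_mnm (k : 'X_{1..r}) :=
  forall i j, i != j -> (0 < k i)%N -> (0 < k j)%N -> normal i j.

(** This is the termination measure on the coordinate ring of the target space, unrelated to the
    weight [om] on the source. *)
Definition height (k : 'X_{1..r}) := (\sum_i k i * mu i)%N.

Lemma heightD a b : height (a + b)%MM = (height a + height b)%N.
Proof.
by rewrite /height -big_split; apply: eq_bigr => i _; rewrite mnmDE mulnDl.
Qed.

Lemma height1 i : height U_(i)%MM = mu i.
Proof.
rewrite /height (bigD1 i) //= big1 ?addn0 ?mnm1E ?eqxx ?mul1n // => j nji.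
by rewrite mnm1E eq_sym (negPf nji).
Qed.

Hypothesis reduce : forall i j, i != j -> ~~ normal i j -> exists2 h,
  ideal_gen J ('X_i * 'X_j - h) & forall k, k \in msupp h -> (height k < mu i + mu j)%N.

Definition reducible f := exists2 g,
  ideal_gen J (f - g) & forall k, k \in msupp g -> normal_mnm k.

Lemma reducible_supp f : (forall k, k \in msupp f -> reducible 'X_[k]) -> reducible f.
Proof.
move=> red; rewrite (mpolyE f); elim: (msupp f) red => [|k s IH] red.
  rewrite big_nil; exists 0; first by rewrite subrr; exact: ideal_gen0.
  by move=> k; rewrite msupp0.
rewrite big_cons; have [g Jg ng] := red k (mem_head _ _).
have [|g' Jg' ng'] := IH; first by move=> k' k's; apply: red; rewrite inE k's orbT.
exists (f@_k *: g + g').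
  rewrite opprD addrACA -scalerBr.
  by apply: ideal_genD => //; exact: ideal_genZ.
move=> j /msuppD_le; rewrite mem_cat => /orP[/msuppZ_le|]; [exact: ng | exact: ng'].
Qed.

(** Strong induction on the height: a monomial that is not normal is divisible by some [X_i X_j]
    with [i != j], which is replaced by terms of smaller height. *)
Lemma reducible_mnm k : reducible 'X_[k].
Proof.
have [N ltN] := ubnP (height k); elim: N => // N IH in k ltN *.
have [/existsP [i /existsP [j /and4P [nij ki kj nn]]]|/existsPn nor] := boolP
  [exists i, exists j, [&& i != j, (0 < k i)%N, (0 < k j)%N & ~~ normal i j]]; last first.
  exists 'X_[k]; first by rewrite subrr; exact: ideal_gen0.
  move=> k'; rewrite msuppX inE => /eqP -> i j nij ki kj.
  by have /existsPn /(_ j) := nor i; rewrite nij ki kj /= negbK.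
have [h Jh hlow] := reduce nij nn.
pose k0 := (k - (U_(i) + U_(j)))%MM.
have kE : k = (U_(i) + U_(j) + k0)%MM.
  rewrite addmC submK //; apply/mnm_lepP => l; rewrite mnmDE !mnm1E.
  case: (i =P l) (j =P l) nij => [<-|_] [E|_] //; first by rewrite E eqxx.
  by rewrite -E.
have [|g Jg ng] := @reducible_supp (h * 'X_[k0]).
  move=> k'; rewrite (perm_mem (msuppMX _ _)) => /mapP [l lh ->].
  apply: IH; move: ltN; rewrite kE !heightD !height1; have := hlow l lh; lia.
exists g => //; rewrite kE !mpolyXD.
have -> : 'X_i * 'X_j * 'X_[k0] - g = 'X_[k0] * ('X_i * 'X_j - h) + (h * 'X_[k0] - g).
  ring.
by apply: ideal_genD => //; exact: ideal_genM.
Qed.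

Hypothesis J_vanish : forall f, J f -> forall x : 'I_m -> K,
  f.@[fun j => (tnth G j).@[x]] = 0.
Hypothesis weight_inj : forall k k', normal_mnm k -> normal_mnm k' ->
  weight k = weight k' -> k = k'.

(** Modulo [J], [f] equals a combination [g] of normal monomials. As [J] vanishes on the image, [g]
    is in the kernel too, and the independence of the images of normal monomials gives [g = 0]. *)
Lemma kernel_sub_ideal f :
  (forall x : 'I_m -> K, f.@[fun j => (tnth G j).@[x]] = 0) -> ideal_gen J f.
Proof.
move=> f0; have [g Jfg ng] : reducible f.
  by apply: reducible_supp => k _; exact: reducible_mnm.
suff g0 : g = 0 by rewrite g0 subr0 in Jfg.
apply: leading_independent => [k k' /ng nk /ng nk'|x].
  exact: (weight_inj nk nk').
case: Jfg => s [sJ /(congr1 (meval (fun j => (tnth G j).@[x])))].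
rewrite mevalB f0 sub0r => /(canRL (@opprK _)) ->.
rewrite (big_morph _ (mevalD _) (meval0 _)) big1_seq ?oppr0 // => u /andP[_ us].
by rewrite mevalM (J_vanish (sJ u us)) mulr0.
Qed.

End LeadingTerms.

(** * Ideals of parametrized cones *)

Section LinearSubstitution.

Variables (K : closedFieldType) (n : nat).

(** This is the pullback of [f] along [y |-> y *m P]. Column [j] of [P] holds the coefficients of
    the new coordinate [j], hence the transpose. *)
Definition linsubst (P : 'M[K]_n) (f : {mpoly K[n]}) : {mpoly K[n]} :=
  f \mPo [tuple linform (row j P^T) | j < n].

Lemma linform_eval (v : 'rV[K]_n) (x : 'I_n -> K) : (linform v).@[x] = \sum_i v 0 i * x i.
Proof.
rewrite (big_morph _ (mevalD _) (meval0 _)); apply: eq_bigr => i _.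
by rewrite mevalZ mevalXU.
Qed.

Lemma linsubst_eval P f (y : 'rV[K]_n) : (linsubst P f).@[y 0] = f.@[(y *m P) 0].
Proof.
rewrite comp_mpoly_meval; apply: meval_eq => j; rewrite tnth_mktuple linform_eval.
by rewrite mxE; apply: eq_bigr => i _; rewrite !mxE mulrC.
Qed.

Lemma mpoly_row_ext (f g : {mpoly K[n]}) :
  (forall y : 'rV[K]_n, f.@[y 0] = g.@[y 0]) -> f = g.
Proof.
move=> E; apply/eqP; rewrite -subr_eq0; apply/eqP/mpoly_fun_eq0 => x.
have := E (\row_i x i); rewrite mevalB => Ex; apply/eqP; rewrite subr_eq0; apply/eqP.
by move: Ex; rewrite !(meval_eq (v1 := (\row_i x i) 0) (v2 := x)) // => i; rewrite mxE.
Qed.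

Lemma linsubstK (P Q : 'M[K]_n) : P *m Q = 1%:M -> cancel (linsubst Q) (linsubst P).
Proof. by move=> PQ f; apply: mpoly_row_ext => y; rewrite !linsubst_eval -mulmxA PQ mulmx1. Qed.

Lemma linsubst_rank k P q : quadric_rank_le k q -> quadric_rank_le k (linsubst P q).
Proof.
case=> A [symA -> rkA]; exists (P *m A *m P^T); split.
- by rewrite !trmx_mul trmxK symA mulmxA.
- have := quadform_congr A P^T; rewrite trmxK /quadform => ->.
  rewrite /linsubst linear_sum; apply: eq_bigr => i _.
  rewrite linear_sum; apply: eq_bigr => j _.
  by rewrite linearZ /= rmorphM /= !comp_mpolyXU -!tnth_nth !tnth_mktuple.
- by apply: leq_trans (mxrankM_maxl _ _) _; apply: leq_trans (mxrankM_maxr _ _) _.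
Qed.

Definition gen_in_rank (I : {mpoly K[n]} -> Prop) (k : nat) :=
  exists G : {mpoly K[n]} -> Prop,
    (forall q, G q -> quadric_rank_le k q) /\ (forall f, I f <-> ideal_gen G f).

Lemma linsubst_ideal_gen P (G : {mpoly K[n]} -> Prop) f :
  ideal_gen G f -> ideal_gen (fun q' => exists2 q, G q & q' = linsubst P q) (linsubst P f).
Proof.
case=> s [sG ->]; exists [seq (linsubst P u.1, linsubst P u.2) | u <- s]; split.
  by move=> u /mapP [v /sG Gv ->]; exists v.2.
rewrite big_map /linsubst linear_sum; apply: eq_bigr => u _.
by rewrite /= rmorphM.
Qed.

Lemma ideal_gen_sub (G G' : {mpoly K[n]} -> Prop) f :
  (forall q, G q -> G' q) -> ideal_gen G f -> ideal_gen G' f.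
Proof. by move=> sub [s [sG ->]]; exists s; split=> // u /sG /sub. Qed.

Lemma gen_in_rank_linsubst (I I' : {mpoly K[n]} -> Prop) (P Q : 'M[K]_n) k :
  P *m Q = 1%:M -> (forall f, I f <-> I' (linsubst P f)) ->
  gen_in_rank I k -> gen_in_rank I' k.
Proof.
move=> PQ II' [G [rkG IG]]; have QP := mulmx1C PQ.
exists (fun q' => exists2 q, G q & q' = linsubst P q); split.
  by move=> q' [q /rkG rkq ->]; exact: linsubst_rank.
move=> f; rewrite -{1}(linsubstK PQ f) -II' IG; split=> [/(linsubst_ideal_gen P)|].
  by rewrite linsubstK.
move=> /(linsubst_ideal_gen Q); apply: ideal_gen_sub => q [_ [q' Gq' ->] ->].
by rewrite linsubstK.
Qed.

Lemma mnm2_eq (i j b c : 'I_n) : (U_(i) + U_(j) == U_(b) + U_(c))%MM =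
  ((i == b) && (j == c)) || ((i == c) && (j == b)).
Proof.
apply/eqP/idP => [/mnmP E|/orP[] /andP[/eqP -> /eqP ->] //]; last by rewrite addmC.
have := E i; have := E j; have := E b; have := E c; rewrite !mnmDE !mnm1E !eqxx.
rewrite ![(b == i)]eq_sym ![(c == i)]eq_sym ![(b == j)]eq_sym ![(c == j)]eq_sym.
rewrite [j == i]eq_sym [c == b]eq_sym.
by case: eqP => [->|_]; case: (j =P c) => //; case: eqP; case: eqP; case: eqP; case: eqP => //.
Qed.

Lemma quadform_coef (A : 'M[K]_n) b c :
  (quadform A)@_(U_(b) + U_(c)) = if b == c then A b b else A b c + A c b.
Proof.
have coef i j : (A i j *: ('X_i * 'X_j : {mpoly K[n]}))@_(U_(b) + U_(c)) =
    A i j *+ (((i == b) && (j == c)) || ((i == c) && (j == b))).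
  by rewrite mcoeffZ -mpolyXD mcoeffX mnm2_eq mulr_natr.
rewrite /quadform raddf_sum /= (eq_bigr (fun i => \sum_j A i j *+
  (((i == b) && (j == c)) || ((i == c) && (j == b))))); last first.
  by move=> i _; rewrite raddf_sum; apply: eq_bigr => j _; exact: coef.
case: eqP => [<-|/eqP nbc].
  rewrite (bigD1 b) //= [X in _ + X]big1 ?addr0 => [|i nib].
    rewrite (bigD1 b) //= big1 ?addr0 ?eqxx // => j njb.
    by rewrite (negPf njb) andbF.
  by apply: big1 => j _; rewrite (negPf nib).
have ncb : (c == b) = false by rewrite eq_sym (negPf nbc).
rewrite (bigD1 b) //= [X in _ + X](bigD1 c) ?ncb //= addrA.
rewrite [X in _ + X]big1 ?addr0 => [|i /andP[nib nic]].
  congr (_ + _).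
    rewrite (bigD1 c) //= big1 ?addr0 ?eqxx // => j njc.
    by rewrite (negPf njc) (negPf nbc).
  rewrite (bigD1 b) //= big1 ?addr0 ?eqxx ?orbT // => j njb.
  by rewrite (negPf njb) andbF.
by apply: big1 => j _; rewrite (negPf nib) (negPf nic).
Qed.

Lemma quadform_homog (A : 'M[K]_n) : quadform A \is 2.-homog.
Proof.
apply: rpred_sum => i _; apply: rpred_sum => j _; apply: rpredZ.
by rewrite -mpolyXD dhomogX /= mdegD !mdeg1.
Qed.

(** In degree [d] only the constant term of [p] can meet the homogeneous [q]. *)
Lemma homog_coef_mul d (p q : {mpoly K[n]}) (k : 'X_{1..n}) :
  q \is d.-homog -> mdeg k = d -> q@_k = 0 -> (p * q)@_k = 0.
Proof.
move=> hq dk q0; rewrite mcoeffM big1 // => -[[a lta] [b ltb]] /= /eqP kE {lta ltb}.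
have [->|] := eqVneq (q@_b) 0; first by rewrite mulr0.
rewrite -mcoeff_msupp => bq; have /dhomogP /(_ b bq) db := hq.
have a0 : mdeg a = 0%N by have := congr1 mdeg kE; rewrite /= mdegD db dk; lia.
move/eqP: a0; rewrite mdeg_eq0 => /eqP a0; have kb : k = b by rewrite kE a0 add0m.
by move: bq; rewrite mcoeff_msupp -kb q0 eqxx.
Qed.

(** The generators are themselves kernel quadrics of small rank, so their coefficient at [X_b X_c]
    is zero. By degree this persists in every combination of them, contrary to [q0]. *)
Lemma not_gen_in_rank (I : {mpoly K[n]} -> Prop) (k : nat) (b c : 'I_n) q0 :
  I q0 -> q0@_(U_(b) + U_(c)) != 0 ->
  (forall A : 'M[K]_n, A^T = A -> (\rank A <= k)%N -> I (quadform A) ->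
    (if b == c then A b b else A b c + A c b) = 0) ->
  ~ gen_in_rank I k.
Proof.
move=> Iq0 nz vanish [G [rkG IG]]; case/eqP: nz.
have [s [sG ->]] := iffLR (IG q0) Iq0.
rewrite raddf_sum big1_seq //= => u us.
have Gu := sG u us; have Iu : I u.2 by apply/IG/ideal_gen_mem.
have [A [symA uE rkA]] := rkG _ Gu; rewrite -/(quadform A) in uE.
apply: (@homog_coef_mul 2); first by rewrite uE quadform_homog.
  by rewrite mdegD !mdeg1.
by rewrite uE quadform_coef vanish // -uE.
Qed.

End LinearSubstitution.

Section Parametrization.

Variables (K : closedFieldType).

Lemma in_hideal_closure (n : nat) (Y : pset K n) f :
  in_hideal (zariski_closure Y) f <-> in_hideal Y f.
Proof.
split=> Yf d x x0 Yx; last first.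
  case: Yx => _; apply; move=> e y y0 Yy.
  (* A homogeneous component of [f] has only itself as nonzero component, so it again lies in the
     ideal. *)
  have [<-|nde] := eqVneq d e; first by rewrite pihomog_id Yf.
  by rewrite (pihomog_ne0 nde) ?meval0 // pihomogP.
by apply: Yf => //; split=> // g Yg; rewrite (pihomog_partitionE (leqnn (msize g)))
  (big_morph _ (mevalD _) (meval0 _)) big1 // => e _; exact: Yg.
Qed.

Lemma homog_eval (n d : nat) (f : {mpoly K[n]}) (c : K) (y : 'rV[K]_n) :
  f \is d.-homog -> f.@[(c *: y) 0] = c ^+ d * f.@[y 0].
Proof.
move=> /dhomogP hf; rewrite !mevalE mulr_sumr !big_seq.
apply: eq_bigr => k kf; rewrite mulrCA; congr (_ * _).
have /= <- := hf k kf; rewrite mdegE (big_morph _ (exprD c) (expr0 c)) -big_split.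
by apply: eq_bigr => i _; rewrite mxE exprMn.
Qed.

(** If [s ^ d.+1 = t], then [f] at [F (s *: x)] is a polynomial in [t] whose coefficients are the
    homogeneous components of [f] at [F x]. Every [t] has such a root [s], so the vanishing of [f]
    along the parametrization forces that of each component. *)
Lemma in_hideal_param (m n d : nat) (F : 'rV[K]_m -> 'rV[K]_n) (X : pset K n) f :
  (forall c x, F (c *: x) = c ^+ d.+1 *: F x) ->
  (forall x, F x != 0 -> X (F x)) ->
  (forall y, y != 0 -> X y -> exists c x, y = c *: F x) ->
  (exists x, F x != 0) ->
  in_hideal X f <-> (forall x, f.@[(F x) 0] = 0).
Proof.
move=> Fhom FX XF [x1 Fx1].
have part (y : 'rV[K]_n) : f.@[y 0] = \sum_(e < msize f) (pihomog mdeg e f).@[y 0].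
  by rewrite {1}(pihomog_partitionE (leqnn (msize f)))
    (big_morph _ (mevalD _) (meval0 _)).
split=> [Xf x|F0 e y y0 /(XF y y0) [c [x ->]]].
  rewrite part big1 // => e _.
  have [Fx0|Fx] := eqVneq (F x) 0; last by apply: Xf => //; exact: FX.
  have he : pihomog mdeg e f \is e.-homog by exact: pihomogP.
  (* The origin is written as a multiple of the point [F x1]; this also covers the component of
     degree 0. *)
  rewrite Fx0 -(scale0r (F x1)) (homog_eval _ _ he) Xf ?mulr0 //; exact: FX.
rewrite (homog_eval (d := e)) ?pihomogP //.
suff -> : (pihomog mdeg e f).@[(F x) 0] = 0 by rewrite mulr0.
have [lte|] := ltnP e (msize f); last first.
  move=> le; rewrite pihomogE big_seq_cond big1 ?meval0 // => k /andP[kf /eqP E].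
  by have := msize_mdeg_lt kf; rewrite E ltnNge le.
pose cf k := (pihomog mdeg k f).@[(F x) 0].
apply: (@closed_coef_eq0 K (msize f) cf _ _ lte) => t.
pose p : {poly K} := 'X^(d.+1) - t%:P.
have [|s /eqP] := @closed_rootP K p _; first by rewrite size_XnsubC.
rewrite hornerD hornerN hornerXn hornerC => /eqP; rewrite subr_eq0 => /eqP sE.
transitivity (f.@[(F (s *: x)) 0]); last exact: F0.
rewrite Fhom sE part; apply: eq_bigr => k _.
by rewrite /cf mulrC (homog_eval (d := k)) ?pihomogP.
Qed.

Definition vanishes (m r : nat) (G : r.-tuple {mpoly K[m]}) (f : {mpoly K[r]}) :=
  forall x : 'I_m -> K, f.@[fun j => (tnth G j).@[x]] = 0.

Definition param (m r : nat) (G : r.-tuple {mpoly K[m]}) (x : 'rV[K]_m) : 'rV[K]_r :=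
  \row_j (tnth G j).@[x 0].

Lemma vanishes_param (m r : nat) (G : r.-tuple {mpoly K[m]}) f :
  vanishes G f <-> (forall x, f.@[(param G x) 0] = 0).
Proof.
split=> f0 x; first by rewrite -(f0 (x 0)); apply: meval_eq => j; rewrite mxE.
rewrite -(f0 (\row_i x i)); apply: meval_eq => j; rewrite mxE.
by apply: meval_eq => i; rewrite mxE.
Qed.

(** Invertible substitutions preserve rank bounds, so the rank index can be computed on the kernel
    of the parametrization. *)
Lemma rank_index_param (m r k : nat) (G : r.-tuple {mpoly K[m]}) (X : pset K r)
    (P Q : 'M[K]_r) :
  P *m Q = 1%:M ->
  (forall f, in_hideal X f <-> forall x, f.@[(param G x *m P) 0] = 0) ->
  gen_in_rank (vanishes G) k ->
  (forall j, (j < k)%N -> ~ gen_in_rank (vanishes G) j) ->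
  rank_index X k.
Proof.
move=> PQ XG Gk Gj.
have XGP f : in_hideal X f <-> vanishes G (linsubst P f).
  rewrite XG vanishes_param; split=> f0 x; have := f0 x; by rewrite linsubst_eval.
split.
  apply: (gen_in_rank_linsubst (mulmx1C PQ) _ Gk) => f.
  by rewrite XGP linsubstK.
move=> j Xj; rewrite leqNgt; apply/negP => /Gj; apply.
exact: (gen_in_rank_linsubst PQ XGP Xj).
Qed.

End Parametrization.

(** * Unimodular triangulations *)

Local Close Scope ring_scope.

Definition sum_seq (s t : seq nat) := [seq (p.1 + p.2)%N | p <- zip s t].

Section Tables.

Variables (T : seq (seq nat)) (H : seq nat).
Local Notation r := (size T).

Definition pair_sum i j := sum_seq (nth [::] T i) (nth [::] T j).

Definition pair_height i j := (nth 0 H i + nth 0 H j)%N.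

(** The first condition puts the binomial [y_i y_j - y_k y_l] in the toric ideal, where
    [p = (k, l)]; the second makes [y_i y_j] its leading term. *)
Definition lower_pair i j (p : nat * nat) :=
  (pair_sum p.1 p.2 == pair_sum i j) && (pair_height p.1 p.2 < pair_height i j)%N.

Definition pairs := [seq (k, l) | k <- iota 0 r, l <- iota 0 r].

Definition normal_pair i j := ~~ has (lower_pair i j) pairs.

Definition nonnormal_pairs :=
  [seq p <- pairs | (p.1 != p.2) && ~~ normal_pair p.1 p.2].

(* The cells of the unimodular triangulation whose edges are the normal pairs. *)
Definition covers (cells : seq (seq nat)) :=
  let nn := nonnormal_pairs in
  all (fun bs => all (fun p => ~~ (nth false bs p.1 && nth false bs p.2)) nn ==>
         has (fun c => all (fun j => nth false bs j ==> (j \in c)) (iota 0 r)) cells)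
      (foldr (fun _ bss => [seq b :: bs | b <- [:: true; false], bs <- bss])
             [:: [::]] (iota 0 r)).

(** The support of [f], as a boolean vector, is one of those enumerated in [covers]; it contains no
    nonnormal pair, hence lies in a cell. *)
Lemma covers_mem cells (f : nat -> nat) : covers cells ->
  (forall i j, (i < r)%N -> (j < r)%N -> i != j ->
    (0 < f i)%N -> (0 < f j)%N -> normal_pair i j) ->
  exists2 c, c \in cells & forall j, (j < r)%N -> j \notin c -> f j = 0%N.
Proof.
move=> cov nf; pose bs := [seq (0 < f i)%N | i <- iota 0 r].
have bsE j : (j < r)%N -> nth false bs j = (0 < f j)%N.
  by move=> jr; rewrite (nth_map 0%N) ?size_iota // nth_iota.
have bs_in s : [seq (0 < f i)%N | i <- s] \in
    foldr (fun _ bss => [seq b :: bs | b <- [:: true; false], bs <- bss]) [:: [::]] s.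
  elim: s => [|i s IH]; first by rewrite inE.
  by apply: allpairs_f => //; case: (0 < f i)%N.
have /allP/(_ _ (bs_in _))/implyP := cov.
move=> imp; have /imp /= /hasP [c cin /allP cP] : all
    (fun p => ~~ (nth false bs p.1 && nth false bs p.2)) nonnormal_pairs.
  apply/allP => p; rewrite mem_filter => /andP[/andP[np nn] /allpairsP [[k l] /= [+ + pE]]].
  rewrite !mem_iota /= !add0n => ki lj; move: np nn; rewrite pE /= !bsE // => nkl.
  by apply: contra => /andP[]; exact: nf.
exists c => [//|j jr jc]; have := cP j; rewrite mem_iota => /(_ jr).
by rewrite bsE // (negPf jc) implybF; case: (f j).
Qed.

Definition table_weight i (f : nat -> nat) :=
  sumn [seq (nth 0 (nth [::] T j) i * f j)%N | j <- iota 0 r].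

(** This is the injectivity of the exponent map on normal monomials, phrased with plain functions so
    that it reduces to linear arithmetic on finitely many values. *)
Definition unimodular (m : nat) := forall f g : nat -> nat,
  (forall i j, (i < r)%N -> (j < r)%N -> i != j ->
    (0 < f i)%N -> (0 < f j)%N -> normal_pair i j) ->
  (forall i j, (i < r)%N -> (j < r)%N -> i != j ->
    (0 < g i)%N -> (0 < g j)%N -> normal_pair i j) ->
  (forall i, (i < m)%N -> table_weight i f = table_weight i g) ->
  forall j, (j < r)%N -> f j = g j.

(* Boolean tests for the hypotheses of [pivot_mem] and [square_mem]; conditionals,
   unlike [&&], are evaluated lazily by [vm_compute]. *)
Definition tconic i b k := pair_sum i b == pair_sum k k.

Definition tpivot i j k l :=
  if pair_sum i j == pair_sum k l then
    if has (fun b => tconic i b k) (iota 0 r)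
    then has (fun b => tconic i b l) (iota 0 r) else false
  else false.

Definition tsquare i j k l :=
  if pair_sum i j == pair_sum k l then
    has (fun p => if tconic i p k then has (fun u =>
      if tconic u j l then if pair_sum u p == pair_sum k l then
        [|| (u == k) && (p == l), (u == l) && (p == k), tpivot u p k l | tpivot p u k l]
      else false else false) (iota 0 r) else false) (iota 0 r)
  else false.

(** The alternatives run through the symmetries of a binomial: exchanging two factors or the two
    products. *)
Definition rank3_reducible :=
  all (fun p => has (fun q => if lower_pair p.1 p.2 q then
    [|| tpivot p.1 p.2 q.1 q.2, tpivot p.2 p.1 q.1 q.2,
        tpivot q.1 q.2 p.1 p.2, tpivot q.2 q.1 p.1 p.2,
        tsquare p.1 p.2 q.1 q.2 | tsquare p.2 p.1 q.1 q.2] else false) pairs) nonnormal_pairs.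

End Tables.


Lemma covers_all T H cells f : covers T H cells ->
  (forall i j, (i < size T)%N -> (j < size T)%N -> i != j ->
    (0 < f i)%N -> (0 < f j)%N -> normal_pair T H i j) ->
  exists2 c, c \in cells & all (fun j => (j \in c) || (f j == 0%N)) (iota 0 (size T)).
Proof.
move=> cov nf; have [c cin zf] := covers_mem cov nf; exists c => //.
apply/allP => j; rewrite mem_iota => /andP[_ jr].
by case: (boolP (j \in c)) => //= jc; rewrite zf.
Qed.

(** Two normal supports lie in cells [c] and [d]. Injectivity, inside one cell or across two, thus
    becomes a finite list of linear systems, one for each pair of cells. *)
Lemma unimodular_cells T H cells m : covers T H cells ->
  (forall f g c d, c \in cells -> d \in cells ->
    all (fun i => table_weight T i f == table_weight T i g) (iota 0 m) ->
    all (fun j => (j \in c) || (f j == 0%N)) (iota 0 (size T)) ->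
    all (fun j => (j \in d) || (g j == 0%N)) (iota 0 (size T)) ->
    all (fun j => f j == g j) (iota 0 (size T))) ->
  unimodular T H m.
Proof.
move=> cov cells_inj f g nf ng E j jr.
have [c cin zf] := covers_all cov nf; have [d din zg] := covers_all cov ng.
have /allP/(_ j) : all (fun j => f j == g j) (iota 0 (size T)).
  apply: cells_inj cin din _ zf zg.
  by apply/allP => i; rewrite mem_iota => im; apply/eqP/E.
by rewrite mem_iota => /(_ jr)/eqP.
Qed.

Ltac split_cells :=
  repeat match goal with
  | H : is_true (_ \in [::]) |- _ => by []
  | H : is_true (_ \in _ :: _) |- _ =>
      move: H; rewrite in_cons => /orP[/eqP ?|H]; [subst|]
  end.

Ltac split_conj :=
  repeat match goal with
  | |- is_true ((_ == _) && _) -> _ => let A := fresh "A" in move=> /andP [/eqP A]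
  | |- is_true true -> _ => move=> _
  end.

Ltac solve_cells :=
  let f := fresh "f" in let g := fresh "g" in
  let cin := fresh "cin" in let din := fresh "din" in
  move=> f g ? ? cin din; rewrite /table_weight /=;
  match type of cin with is_true (in_mem _ (mem ?cs)) =>
    let cs' := eval vm_compute in cs in
    change cs with cs' in cin, din
  end;
  repeat match goal with |- context [f ?i] => generalize (f i); intro end;
  repeat match goal with |- context [g ?i] => generalize (g i); intro end;
  split_conj; split_cells; rewrite /=; lia.

(** * The lattice polygons and their triangulations *)

(** The cubes of the variables come first: dropping [t <= 3] entries leaves the cubic monomials that
    vanish at the first [t] coordinate points. *)
Definition cubics : seq (seq nat) :=
  [:: [:: 3; 0; 0]; [:: 0; 3; 0]; [:: 0; 0; 3]; [:: 2; 1; 0]; [:: 2; 0; 1];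
      [:: 1; 2; 0]; [:: 1; 1; 1]; [:: 1; 0; 2]; [:: 0; 2; 1]; [:: 0; 1; 2]].

(** Lifting by the squared norm induces the Delaunay triangulation, here by unit lattice
    triangles. *)
Definition sq_heights (T : seq (seq nat)) := [seq sumn [seq (a * a)%N | a <- w] | w <- T].

Definition cubic_cells : seq (seq nat) :=
  [:: [:: 0; 3; 4]; [:: 1; 5; 8]; [:: 2; 7; 9]; [:: 3; 4; 6]; [:: 3; 5; 6];
      [:: 4; 6; 7]; [:: 5; 6; 8]; [:: 6; 7; 9]; [:: 6; 8; 9]].

(** Each vertex of the big triangle lies in a single corner cell, which disappears with it; the
    remaining indices are shifted. *)
Definition drop_cells t (cells : seq (seq nat)) :=
  [seq [seq (j - t)%N | j <- c] | c <- cells & all (leq t) c].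

Lemma cubics_cover (t : nat) : (t <= 3)%N ->
  covers (drop t cubics) (sq_heights (drop t cubics)) (drop_cells t cubic_cells).
Proof. by case: t => [|[|[|[|]]]] // _; vm_compute. Qed.

Lemma cubics_unimodular (t : nat) : (t <= 3)%N ->
  unimodular (drop t cubics) (sq_heights (drop t cubics)) 3.
Proof.
move=> t3; apply: (unimodular_cells (cubics_cover t3)).
by case: t t3 => [|[|[|[|]]]] // _; solve_cells.
Qed.

Lemma cubics_rank3 : rank3_reducible cubics (sq_heights cubics).
Proof. by vm_compute. Qed.

(* Leading monomials of the cubics through the four points, and the weights of
   a monomial order on the coordinates of [P^5]. *)
Definition pentagon := take 6 (drop 3 cubics).
Definition pentagon_heights := [:: 10; 9; 9; 6; 7; 7].

Lemma pentagon_cover : covers pentagon pentagon_heights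
  [:: [:: 0; 1; 3]; [:: 0; 2; 3]; [:: 1; 3; 4]; [:: 2; 3; 5]; [:: 3; 4; 5]].
Proof. by vm_compute. Qed.

Lemma pentagon_unimodular : unimodular pentagon pentagon_heights 3.
Proof. apply: (unimodular_cells pentagon_cover); solve_cells. Qed.

(* Exponents of [s_0, s_1, t_0, t_1] in the forms of bidegree (2, 2). *)
Definition biquadrics : seq (seq nat) :=
  [:: [:: 0; 2; 0; 2]; [:: 0; 2; 1; 1]; [:: 0; 2; 2; 0];
      [:: 1; 1; 0; 2]; [:: 1; 1; 1; 1]; [:: 1; 1; 2; 0];
      [:: 2; 0; 0; 2]; [:: 2; 0; 1; 1]; [:: 2; 0; 2; 0]].
(** These heights cut the four unit squares of the grid along parallel diagonals; with squared norms
    the two diagonals of each square would tie. *)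
Definition biquadric_heights := [:: 8; 10; 16; 6; 6; 10; 8; 6; 8].

Lemma biquadrics_cover : covers biquadrics biquadric_heights
  [:: [:: 0; 1; 4]; [:: 0; 3; 4]; [:: 1; 2; 5]; [:: 1; 4; 5];
      [:: 3; 4; 7]; [:: 3; 6; 7]; [:: 4; 5; 8]; [:: 4; 7; 8]].
Proof. by vm_compute. Qed.

Lemma biquadrics_unimodular : unimodular biquadrics biquadric_heights 4.
Proof. apply: (unimodular_cells biquadrics_cover); solve_cells. Qed.

Lemma biquadrics_rank3 : rank3_reducible biquadrics biquadric_heights.
Proof. by vm_compute. Qed.

Local Open Scope ring_scope.

(** * Toric ideals *)

Section Kernel.

Variables (K : closedFieldType) (m r : nat) (G : r.-tuple {mpoly K[m]}).

Definition kernel_quadric (k : nat) (q : {mpoly K[r]}) :=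
  quadric_rank_le k q /\ vanishes G q.

Lemma gen_in_rank_kernel k :
  (forall f, vanishes G f -> ideal_gen (kernel_quadric k) f) ->
  gen_in_rank (vanishes G) k.
Proof.
move=> gen; exists (kernel_quadric k); split=> [q []|f] //; split; first exact: gen.
case=> s [sG ->] x; rewrite (big_morph _ (mevalD _) (meval0 _)) big1_seq // => u /andP[_ us].
by rewrite mevalM; have [_ ->] := sG u us; rewrite mulr0.
Qed.

Local Notation X i := ('X_i : {mpoly K[r]}).
Hypothesis char_neq2 : 2%:R != 0 :> K.

Lemma quadric4_mem (a b c d : 'rV[K]_r) :
  vanishes G (linform a * linform b - linform c * linform d) ->
  ideal_gen (kernel_quadric 4) (linform a * linform b - linform c * linform d).
Proof. by move=> v; apply: ideal_gen_mem; split=> //; exact: quadric_rank4. Qed.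

Lemma binomial4_mem i j k l : vanishes G (X i * X j - X k * X l) ->
  ideal_gen (kernel_quadric 4) (X i * X j - X k * X l).
Proof. rewrite -!linform_delta; exact: quadric4_mem. Qed.

Lemma quadric3_mem (a b c : 'rV[K]_r) :
  vanishes G (linform a * linform b - linform c ^+ 2) ->
  ideal_gen (kernel_quadric 3) (linform a * linform b - linform c ^+ 2).
Proof. by move=> v; apply: ideal_gen_mem; split=> //; exact: quadric_rank3. Qed.

Lemma mpoly_half (p : {mpoly K[r]}) : p = 2%:R^-1 *: (p + p).
Proof. by rewrite -mulr2n -scaler_nat scalerA mulVf // scale1r. Qed.

Local Notation ev i x := ((tnth G i).@[x]).

Lemma conic3_mem i b k : (forall x, ev i x * ev b x = ev k x * ev k x) ->
  ideal_gen (kernel_quadric 3) (X i * X b - X k ^+ 2).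
Proof.
rewrite -!linform_delta => e; apply: quadric3_mem => x.
by rewrite expr2 mevalB !mevalM !linform_delta !mevalXU e subrr.
Qed.

(* Polarization of [s |-> X_i * b(s) - s ^ 2] at [s = X_k, X_l]. *)
Lemma pivot_mem i j k l b c :
  (forall x, ev i x * ev j x = ev k x * ev l x) ->
  (forall x, ev i x * ev b x = ev k x * ev k x) ->
  (forall x, ev i x * ev c x = ev l x * ev l x) ->
  ideal_gen (kernel_quadric 3) (X i * X j - X k * X l).
Proof.
move=> ij ib ic.
have q1 := conic3_mem ib; have q2 := conic3_mem ic.
(* This is the value at [X_k + X_l]; subtracting those at [X_k] and [X_l] leaves twice the
   binomial. *)
have q3 : ideal_gen (kernel_quadric 3)
    (X i * (X b + X c + 2%:R *: X j) - (X k + X l) ^+ 2).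
  rewrite -!linform_delta -linformZ -!linformD; apply: quadric3_mem => x.
  rewrite expr2 mevalB !mevalM !linformD linformZ !linform_delta.
  rewrite !mevalD mevalZ !mevalXU !mulrDr mulrCA ij ib ic; ring.
rewrite [Z in ideal_gen _ Z]mpoly_half; apply: ideal_genZ.
have := ideal_genB (ideal_genB q3 q1) q2; congr (ideal_gen _ _).
by rewrite scaler_nat; ring.
Qed.

(* Polarization of [(a, s, b) |-> a * b - s ^ 2]. *)
Lemma square_mem i j k l p u :
  (forall x, ev i x * ev j x = ev k x * ev l x) ->
  (forall x, ev u x * ev p x = ev k x * ev l x) ->
  (forall x, ev i x * ev p x = ev k x * ev k x) ->
  (forall x, ev u x * ev j x = ev l x * ev l x) ->
  ideal_gen (kernel_quadric 3) (X u * X p - X k * X l) ->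
  ideal_gen (kernel_quadric 3) (X i * X j - X k * X l).
Proof.
move=> ij up ip uj q0.
have q1 := conic3_mem ip; have q2 := conic3_mem uj.
(* Without its two pure conics this leaves [X_i X_j + X_u X_p - 2 X_k X_l], and the known binomial
   [q0] removes the rest. *)
have q3 : ideal_gen (kernel_quadric 3)
    ((X i + X u) * (X p + X j) - (X k + X l) ^+ 2).
  rewrite -!linform_delta -!linformD; apply: quadric3_mem => x.
  rewrite expr2 mevalB !mevalM !linformD !linform_delta.
  rewrite !mevalD !mevalXU !mulrDr !mulrDl ij ip uj up; ring.
have := ideal_genB (ideal_genB (ideal_genB q3 q1) q2) q0; congr (ideal_gen _ _); ring.
Qed.

End Kernel.

Lemma has_ord (n : nat) (P : pred nat) : has P (iota 0 n) -> exists i : 'I_n, P i.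
Proof.
by case/hasP => i; rewrite mem_iota add0n => /andP[_ lti] Pi; exists (Ordinal lti).
Qed.

Definition monom m (s : seq nat) : 'X_{1..m} := [multinom nth 0%N s i | i < m].

Lemma monom_sum_eq m (s t u v : seq nat) :
  [&& size s == m, size t == m, size u == m & size v == m] ->
  (monom m s + monom m t == monom m u + monom m v)%MM = (sum_seq s t == sum_seq u v).
Proof.
case/and4P => /eqP ss /eqP st /eqP su /eqP sv.
have nE (a b : seq nat) c (cm : (c < m)%N) : size a = m -> size b = m ->
    nth 0%N (sum_seq a b) c = (monom m a + monom m b)%MM (Ordinal cm).
  move=> sa sb; rewrite (nth_map (0, 0)%N) ?size_zip ?sa ?sb ?minnn // nth_zip ?sa //=.
  by rewrite !mnmE.
have szp (a b : seq nat) : size a = m -> size b = m -> size (sum_seq a b) = m.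
  by move=> sa sb; rewrite size_map size_zip sa sb minnn.
apply/eqP/eqP => [E|E].
  apply: (@eq_from_nth _ 0%N) => [|c]; rewrite !szp // => cm.
  by rewrite !(nE _ _ _ cm) // E.
by apply/mnmP => -[c cm]; rewrite -!nE // E.
Qed.

Section Toric.

Variables (K : closedFieldType) (T : seq (seq nat)) (H : seq nat) (m : nat).
Hypothesis size_T : all (fun w => size w == m) T.
Local Notation r := (size T).

Definition tmonom (j : 'I_r) : 'X_{1..m} := monom m (nth [::] T j).

Definition toric : r.-tuple {mpoly K[m]} := [tuple 'X_[tmonom j] | j < r].

Lemma pair_sum_monom (i j k l : 'I_r) : pair_sum T i j == pair_sum T k l ->
  (tmonom i + tmonom j = tmonom k + tmonom l)%MM.
Proof.
move=> S; apply/eqP; rewrite monom_sum_eq //; move/allP: size_T => sT.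
by rewrite !sT ?mem_nth.
Qed.

Lemma pair_sum_eval (i j k l : 'I_r) x : pair_sum T i j == pair_sum T k l ->
  (tnth toric i).@[x] * (tnth toric j).@[x] = (tnth toric k).@[x] * (tnth toric l).@[x].
Proof.
move=> /pair_sum_monom E; rewrite !tnth_mktuple -!mevalM -!mpolyXD.
by rewrite E.
Qed.

Definition tnormal : rel 'I_r := fun i j => normal_pair T H i j.

Lemma tweight_inj k k' : unimodular T H m -> normal_mnm tnormal k -> normal_mnm tnormal k' ->
  weight tmonom k = weight tmonom k' -> k = k'.
Proof.
pose f (k : 'X_{1..r}) j := if insub j is Some i then k i else 0%N.
have fE (k0 : 'X_{1..r}) (j : 'I_r) : f k0 j = k0 j by rewrite /f valK.
have nf (k0 : 'X_{1..r}) : normal_mnm tnormal k0 -> forall i j, (i < r)%N -> (j < r)%N ->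
    i != j -> (0 < f k0 i)%N -> (0 < f k0 j)%N -> normal_pair T H i j.
  move=> nk i j ir jr nij; rewrite -[i]/(val (Ordinal ir)) -[j]/(val (Ordinal jr)) !fE.
  by move=> ki kj; apply: nk ki kj.
have wE (k0 : 'X_{1..r}) (i : 'I_m) : table_weight T i (f k0) = weight tmonom k0 i.
  rewrite weightE /table_weight sumnE big_map -[Z in iota 0 Z]subn0 -/(index_iota 0 r) big_mkord.
  by apply: eq_bigr => j _; rewrite mnmE fE.
move=> uni nk nk' E; apply/mnmP => j; rewrite -!fE.
apply: (uni (f k) (f k') (nf k nk) (nf k' nk')) (ltn_ord j) => i im.
by rewrite -[i]/(val (Ordinal im)) !wE E.
Qed.

Definition theight (j : 'I_r) := nth 0%N H j.

Lemma nonnormal_lower (i j : 'I_r) : ~~ tnormal i j ->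
  exists k l : 'I_r, lower_pair T H i j (val k, val l).
Proof.
rewrite negbK => /hasP [p /allpairsP [[k l] /= [+ + ->]]].
rewrite !mem_iota !add0n /= => kr lr low.
by exists (Ordinal kr), (Ordinal lr).
Qed.

Lemma toric_gen k : unimodular T H m ->
  (forall i j : 'I_r, i != j -> ~~ tnormal i j -> exists p q : 'I_r,
    lower_pair T H i j (val p, val q) /\
    ideal_gen (kernel_quadric toric k) ('X_i * 'X_j - 'X_p * 'X_q)) ->
  gen_in_rank (vanishes toric) k.
Proof.
move=> uni red; apply: gen_in_rank_kernel => f f0.
(* The weight is constantly 0: the parametrization is by monomials, which are their own leading
   terms. *)
have omD (a b : 'X_{1..m}) : 0%N = (0 + 0)%N by [].
apply: (@kernel_sub_ideal K m r (fun=> 0%N) omD tmonom toric _ tnormal theight) f0.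
- by move=> j c; rewrite tnth_mktuple subrr mcoeff0 eqxx.
- move=> i j nij nn; have [p [q [/andP[_ low] mem]]] := red i j nij nn.
  exists ('X_p * 'X_q) => // c; rewrite -mpolyXD msuppX inE => /eqP ->.
  by rewrite heightD !height1.
- by move=> g [].
- by move=> c c'; exact: tweight_inj.
Qed.

Hypothesis char_neq2 : 2%:R != 0 :> K.

Lemma toric_gen4 : unimodular T H m -> gen_in_rank (vanishes toric) 4.
Proof.
move=> uni; apply: toric_gen uni _ => i j nij /nonnormal_lower [p [q low]].
exists p, q; split=> //; apply: binomial4_mem => // x.
case/andP: low => S _; rewrite mevalB !mevalM !mevalXU.
by apply/eqP; rewrite subr_eq0; apply/eqP/esym/pair_sum_eval.
Qed.

Lemma tpivot_mem (i j k l : 'I_r) : tpivot T i j k l ->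
  ideal_gen (kernel_quadric toric 3) ('X_i * 'X_j - 'X_k * 'X_l).
Proof.
rewrite /tpivot; case: ifP => // ij; case: ifP => // /has_ord [b ib] /has_ord [c ic].
by apply: (@pivot_mem _ _ _ toric char_neq2 i j k l b c) => x; exact: pair_sum_eval.
Qed.

Lemma tsquare_mem (i j k l : 'I_r) : tsquare T i j k l ->
  ideal_gen (kernel_quadric toric 3) ('X_i * 'X_j - 'X_k * 'X_l).
Proof.
rewrite /tsquare; case: ifP => // ij /has_ord [p]; case: ifP => // ip /has_ord [u].
case: ifP => // uj; case: ifP => // up ex.
apply: (@square_mem _ _ _ toric char_neq2 i j k l p u); try by move=> x; exact: pair_sum_eval.
case/or4P: ex => [/andP[/eqP/val_inj -> /eqP/val_inj ->]|/andP[/eqP/val_inj -> /eqP/val_inj ->]||].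
- by rewrite subrr; exact: ideal_gen0.
- by rewrite (mulrC 'X_l) subrr; exact: ideal_gen0.
- exact: tpivot_mem.
- by rewrite (mulrC 'X_u); exact: tpivot_mem.
Qed.

Lemma toric_gen3 : unimodular T H m -> rank3_reducible T H ->
  gen_in_rank (vanishes toric) 3.
Proof.
move=> uni /allP red; apply: toric_gen uni _ => i j nij nn.
have /red /hasP [q /allpairsP [[k l] /= [+ + qE]]] :
    (val i, val j) \in nonnormal_pairs T H.
  rewrite mem_filter /= nn andbT; apply/andP; split; first by [].
  by apply/allpairsP; exists (val i, val j); rewrite !mem_iota !add0n /= !ltn_ord.
rewrite !mem_iota !add0n /= qE => kr lr; case: ifP => // low ok.
pose k0 := Ordinal kr; pose l0 := Ordinal lr; exists k0, l0; split=> //.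
have {}ok : [|| tpivot T i j k0 l0, tpivot T j i k0 l0, tpivot T k0 l0 i j,
  tpivot T l0 k0 i j, tsquare T i j k0 l0 | tsquare T j i k0 l0] := ok.
case/or4P: ok =>
  [/tpivot_mem //|/tpivot_mem|/tpivot_mem|/or3P[/tpivot_mem|/tsquare_mem //|/tsquare_mem]].
- by rewrite (mulrC 'X_j).
- by rewrite -opprB => /ideal_genN; rewrite opprK.
- by rewrite (mulrC 'X_l0) -opprB => /ideal_genN; rewrite opprK.
- by rewrite (mulrC 'X_j).
Qed.

End Toric.

(** * The quintic del Pezzo surface *)

Section Pentagon.

Variable K : closedFieldType.

Definition pentagon_tails : seq (seq nat) :=
  [:: [:: 1; 1; 1]; [:: 1; 1; 1]; [:: 0; 2; 1]; [:: 0; 1; 2]; [:: 0; 1; 2]; [:: 0; 1; 2]]%N.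

Definition ptail (j : 'I_6) : 'X_{1..3} :=
  monom 3 (nth [::] pentagon_tails j).

Definition pent_monom : 'I_6 -> 'X_{1..3} := @tmonom pentagon 3.

(* With [Q_1 = y (x - z)] and [Q_2 = z (x - y)], whose common zeros are the
   four points, these are [Q_1 x], [Q_2 x], [Q_1 y], [Q_1 z], [Q_2 z] and
   [Q_1 z - Q_2 y]. *)
Definition pent : 6.-tuple {mpoly K[3]} := [tuple 'X_[pent_monom j] - 'X_[ptail j] | j < 6].

Lemma pent_eval (x : 'I_3 -> K) (j : 'I_6) :
  let a := x (inord 0) in let b := x (inord 1) in let c := x (inord 2) in
  (tnth pent j).@[x] = nth 0 [:: a ^+ 2 * b - a * b * c; a ^+ 2 * c - a * b * c;
    a * b ^+ 2 - b ^+ 2 * c; a * b * c - b * c ^+ 2; a * c ^+ 2 - b * c ^+ 2;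
    b ^+ 2 * c - b * c ^+ 2] j.
Proof.
have i0 : (0 : 'I_3) = inord 0 by apply: val_inj; rewrite /= inordK.
have i1 : (lift ord0 ord0 : 'I_3) = inord 1 by apply: val_inj; rewrite /= inordK.
have i2 : (lift ord0 (lift ord0 ord0) : 'I_3) = inord 2 by apply: val_inj; rewrite /= inordK.
rewrite /= tnth_mktuple mevalB !mevalX !big_ord_recl !big_ord0 !mnmE -!i0 -!i1 -!i2 /=.
by case: j => -[|[|[|[|[|[|j]]]]]] //= _; rewrite ?expr0 ?expr1; ring.
Qed.

(** The variables [x], [y], [z] have weights 2, 1, 0, so that each tail is lighter than its leading
    monomial. *)
Definition pent_om (k : 'X_{1..3}) := (2 * k (inord 0) + k (inord 1))%N.

Lemma pent_omD a b : pent_om (a + b)%MM = (pent_om a + pent_om b)%N.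
Proof. rewrite /pent_om !mnmDE; lia. Qed.

Lemma pent_leading j : leading pent_om (pent_monom j) (tnth pent j).
Proof.
rewrite /leading tnth_mktuple addrAC subrr add0r; apply/lowerN/lowerX.
rewrite /pent_om !mnmE !inordK //.
by case: j => -[|[|[|[|[|[|j]]]]]].
Qed.

Definition pent_mu : 'I_6 -> nat := @theight pentagon pentagon_heights.

Hypothesis char_neq2 : 2%:R != 0 :> K.

Local Notation X i := ('X_(inord i) : {mpoly K[6]}).

(** As [h] is a product of two linear forms, [X_a X_b - h] has rank at most 4. *)
Lemma pent_rel (a b : nat) (c d : 'rV[K]_6) (h : {mpoly K[6]}) :
  (a < 6)%N -> (b < 6)%N -> h = linform c * linform d ->
  (forall x, (X a * X b - h).@[fun j => (tnth pent j).@[x]] = 0) ->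
  lower (height pent_mu) (nth 0%N pentagon_heights a + nth 0%N pentagon_heights b) h ->
  exists2 h, ideal_gen (kernel_quadric pent 4) (X a * X b - h) &
    forall k, k \in msupp h -> (height pent_mu k < pent_mu (inord a) + pent_mu (inord b))%N.
Proof.
move=> ar br hE van low; exists h.
  rewrite hE -!linform_delta; apply: quadric4_mem => //.
  by move=> x; have := van x; rewrite hE !linform_delta.
by move=> k; rewrite mcoeff_msupp => /low; rewrite /pent_mu /theight !inordK.
Qed.

Ltac pent_van := let x := fresh "x" in
  move=> x; rewrite !(mevalB, mevalD, mevalM, mevalXU) !pent_eval !inordK //=; ring.

Ltac pent_low := rewrite ?(mulrBl, mulrBr); 
  repeat (first [apply: (@lowerD _ _ (height pent_mu)) | apply: (@lowerN _ _ (height pent_mu))]);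
  rewrite -mpolyXD; apply: lowerX;
  by rewrite heightD !height1 /pent_mu /theight !inordK.

(** The nonnormal pairs are 04, 05, 12, 15 and 24. In the parametrization [X 3 - X 5] is [Q_2 y],
    [X 3 - X 4] is [x z (y - z)] and [X 5] is [y z (y - z)]; each relation regroups the factors of a
    product. *)
Lemma pent_reduce (i j : 'I_6) : i != j -> ~~ @tnormal pentagon pentagon_heights i j ->
  exists2 h, ideal_gen (kernel_quadric pent 4) ('X_i * 'X_j - h) &
    forall k, k \in msupp h -> (height pent_mu k < pent_mu i + pent_mu j)%N.
Proof.
pose D a : 'rV[K]_6 := delta_mx 0 (inord a).
have sym (a b : 'I_6) : (exists2 h, ideal_gen (kernel_quadric pent 4) ('X_a * 'X_b - h) &
    forall k, k \in msupp h -> (height pent_mu k < pent_mu a + pent_mu b)%N) ->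
    exists2 h, ideal_gen (kernel_quadric pent 4) ('X_b * 'X_a - h) &
    forall k, k \in msupp h -> (height pent_mu k < pent_mu b + pent_mu a)%N.
  by case=> h hm hl; exists h; [rewrite (mulrC 'X_b) | move=> k; rewrite addnC; apply: hl].
rewrite -(inord_val i) -(inord_val j); move: (val i) (val j) (ltn_ord i) (ltn_ord j).
move=> {i j} a b a6 b6 _; rewrite /tnormal !inordK //.
have r04 : exists2 h, ideal_gen (kernel_quadric pent 4) (X 0 * X 4 - h) &
    forall k, k \in msupp h -> (height pent_mu k < pent_mu (inord 0) + pent_mu (inord 4))%N.
  apply: (@pent_rel 0 4 (D 3) (D 1) (X 3 * X 1)) => //; first by rewrite !linform_delta.
    pent_van.
  pent_low.
have r05 : exists2 h, ideal_gen (kernel_quadric pent 4) (X 0 * X 5 - h) &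
    forall k, k \in msupp h -> (height pent_mu k < pent_mu (inord 0) + pent_mu (inord 5))%N.
  apply: (@pent_rel 0 5 (D 2) (D 3 - D 4) (X 2 * (X 3 - X 4))) => //.
  - by rewrite linformB !linform_delta.
  - pent_van.
  - pent_low.
have r12 : exists2 h, ideal_gen (kernel_quadric pent 4) (X 1 * X 2 - h) &
    forall k, k \in msupp h -> (height pent_mu k < pent_mu (inord 1) + pent_mu (inord 2))%N.
  apply: (@pent_rel 1 2 (D 0) (D 3 - D 5) (X 0 * (X 3 - X 5))) => //.
  - by rewrite linformB !linform_delta.
  - pent_van.
  - pent_low.
have r15 : exists2 h, ideal_gen (kernel_quadric pent 4) (X 1 * X 5 - h) &
    forall k, k \in msupp h -> (height pent_mu k < pent_mu (inord 1) + pent_mu (inord 5))%N.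
  apply: (@pent_rel 1 5 (D 3 - D 5) (D 3 - D 4) ((X 3 - X 5) * (X 3 - X 4))) => //.
  - by rewrite !linformB !linform_delta.
  - pent_van.
  - pent_low.
have r24 : exists2 h, ideal_gen (kernel_quadric pent 4) (X 2 * X 4 - h) &
    forall k, k \in msupp h -> (height pent_mu k < pent_mu (inord 2) + pent_mu (inord 4))%N.
  apply: (@pent_rel 2 4 (D 3) (D 3 - D 5) (X 3 * (X 3 - X 5))) => //.
  - by rewrite !linformB !linform_delta.
  - pent_van.
  - pent_low.
case: a a6 => [|[|[|[|[|[|a]]]]]] //= _; case: b b6 => [|[|[|[|[|[|b]]]]]] //= _ nn;
  by [ | exact: sym].
Qed.

Lemma pent_gen4 : gen_in_rank (vanishes pent) 4.
Proof.
apply: gen_in_rank_kernel => f f0.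
apply: (kernel_sub_ideal pent_omD pent_leading pent_reduce) f0 => [g []|] // k k' nk nk'.
exact: (tweight_inj pentagon_unimodular).
Qed.

End Pentagon.

(** * Lower bounds *)

Section IsotropicVectors.

Variables (K : fieldType) (n : nat) (A : 'M[K]_n).
Hypothesis symA : A^T = A.

Lemma rows_dependent (a b : 'I_n) : (\rank (col_mx (row a A) (row b A)) < 2)%N ->
  exists s t : K, (s != 0) || (t != 0) /\ forall k, s * A a k + t * A b k = 0.
Proof.
move=> lt2; set N := col_mx _ _ in lt2.
have : kermx N != 0 by rewrite -mxrank_eq0 mxrank_ker subn_eq0 -ltnNge.
case/rowV0Pn => v /sub_kermxP; rewrite -[v]hsubmxK mul_row_col => vN nz.
exists (lsubmx v 0 0), (rsubmx v 0 0); split.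
  apply: contraR nz; rewrite negb_or !negbK => /andP[/eqP l0 /eqP r0].
  apply/eqP; rewrite -row_mx0; congr row_mx; apply/rowP => i; rewrite ord1 [RHS]mxE.
    exact: l0.
  exact: r0.
move=> k; have := congr1 (fun M : 'rV_n => M 0 k) vN.
by rewrite !mxE !big_ord1 !mxE.
Qed.

(* Frobenius' rank inequality for [X A X^T = 0], where [X] has the rows [a], [b]. *)
Lemma isotropic3 (a b c d : 'I_n) : (\rank A <= 3)%N ->
  A a a = 0 -> A a b = 0 -> A b b = 0 -> A a c = 0 -> A a d + A b c = 0 -> A b c = 0.
Proof.
move=> rkA aa ab bb ac adbc.
have sA i j : A i j = A j i by rewrite -{1}symA mxE.
pose N : 'M[K]_(1 + 1, n) := col_mx (delta_mx 0 a) (delta_mx 0 b).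
have NA : N *m A = col_mx (row a A) (row b A) by rewrite mul_col_mx -!rowE.
have NAN : N *m A *m N^T = 0.
  rewrite NA tr_col_mx mul_col_row.
  have e i j : row i A *m (delta_mx 0 j : 'rV_n)^T = (A i j)%:M.
    apply/matrixP => p q; rewrite !ord1 trmx_delta -colE !mxE eqxx; congr (A _ _).
  by rewrite !e aa ab bb (sA b a) ab !raddf0 block_mx0.
have := mxrank_Frobenius N A N^T; rewrite NAN mxrank0 addn0.
have -> : \rank (A *m N^T) = \rank (N *m A) by rewrite -mxrank_tr trmx_mul trmxK symA.
rewrite NA => le; case: (@rows_dependent a b) => [|s [t [nz dep]]].
  (* Twice the rank of the two rows is at most 3, so they are dependent. *)
  by rewrite ltnNge; apply/negP => ge; have := leq_trans (leq_add ge ge) (leq_trans le rkA).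
(* If [t = 0], row [a] is zero and [A a d] vanishes; otherwise column [c] of the dependency gives
   [A b c = 0]. *)
have [t0|nt] := eqVneq t 0.
  have ns : s != 0 by move: nz; rewrite t0 eqxx orbF.
  have /eqP := dep d; rewrite t0 mul0r addr0 mulf_eq0 (negPf ns) /= => /eqP ad.
  by rewrite -adbc ad add0r.
have /eqP := dep c; rewrite ac mulr0 add0r mulf_eq0 (negPf nt) /= => /eqP //.
Qed.

(** Frobenius' inequality, with [a] alone on one side and the pair [a], [b] on the other, bounds the
    sum of the ranks of row [a] and of both rows by 2. If [A a c] is nonzero, so is row [a]; the
    rows are then dependent, and column [b] gives [A b b = 0]. *)
Lemma isotropic2 (a b c : 'I_n) : (\rank A <= 2)%N ->
  A a a = 0 -> A a b = 0 -> A a c *+ 2 + A b b = 0 -> A b b = 0.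
Proof.
move=> rkA aa ab acbb.
pose N : 'M[K]_(1 + 1, n) := col_mx (delta_mx 0 a) (delta_mx 0 b).
pose X : 'M[K]_(1, n) := delta_mx 0 a.
have NA : N *m A = col_mx (row a A) (row b A) by rewrite mul_col_mx -!rowE.
have XAN : X *m A *m N^T = 0.
  rewrite -rowE tr_col_mx mul_mx_row.
  have e i j : row i A *m (delta_mx 0 j : 'rV_n)^T = (A i j)%:M.
    apply/matrixP => p q; rewrite !ord1 trmx_delta -colE !mxE eqxx; congr (A _ _).
  by rewrite !e aa ab !raddf0 row_mx0.
have := mxrank_Frobenius X A N^T; rewrite XAN mxrank0 addn0.
have -> : \rank (A *m N^T) = \rank (N *m A) by rewrite -mxrank_tr trmx_mul trmxK symA.
rewrite NA -rowE => le.
have [ac|nac] := eqVneq (A a c) 0; first by rewrite -acbb ac mul0rn add0r.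
have rka : (0 < \rank (row a A))%N.
  rewrite lt0n mxrank_eq0; apply: contra nac => /eqP r0.
  by have := congr1 (fun M : 'rV_n => M 0 c) r0; rewrite !mxE => ->.
case: (@rows_dependent a b) => [|s [t [nz dep]]].
  by rewrite ltnNge; apply/negP => ge; have := leq_trans (leq_add rka ge) (leq_trans le rkA).
have [t0|nt] := eqVneq t 0.
  have ns : s != 0 by move: nz; rewrite t0 eqxx orbF.
  have /eqP := dep c; rewrite t0 mul0r addr0 mulf_eq0 (negPf ns) /= => ac.
  by rewrite ac in nac.
have /eqP := dep b; rewrite ab mulr0 add0r mulf_eq0 (negPf nt) /= => /eqP //.
Qed.

End IsotropicVectors.

Section Coefficients.

Variables (K : closedFieldType) (m r : nat) (G : r.+1.-tuple {mpoly K[m]}).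

(** A sparse list of the index pairs contributing to one coefficient lets [vm_compute] produce
    explicit linear relations between the entries of [A]. *)
Definition cell_coefs (c : nat -> nat -> int) : seq (nat * nat * int) :=
  [seq (k, c k.1 k.2) |
    k <- [seq (i, j) | i <- iota 0 r.+1, j <- iota 0 r.+1] & c k.1 k.2 != 0].

Lemma quadform_coef_sum (A : 'M[K]_r.+1) (w : 'X_{1..m}) (c : nat -> nat -> int) :
  vanishes G (quadform A) ->
  (forall i j : 'I_r.+1, (tnth G i * tnth G j)@_w = (c i j)%:~R) ->
  \sum_(u <- cell_coefs c) A (inord u.1.1) (inord u.1.2) *~ u.2 = 0.
Proof.
move=> van cE; have van0 : quadform A \mPo G = 0.
  by apply: mpoly_fun_eq0 => x; rewrite comp_mpoly_meval van.
have := congr1 (mcoeff w) van0; rewrite mcoeff0; apply: etrans.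
rewrite /quadform /cell_coefs big_map big_filter big_mkcond big_allpairs.
have dist (F : 'I_r.+1 -> {mpoly K[r.+1]}) :
    ((\sum_i F i) \mPo G)@_w = \sum_i (F i \mPo G)@_w.
  rewrite (big_morph _ (comp_mpolyD G) (comp_mpoly0 G)).
  by rewrite (big_morph _ (mcoeffD w) (mcoeff0 _ w)).
rewrite -[iota 0 r.+1]/(index_iota 0 r.+1) big_mkord dist.
apply: eq_bigr => i _; rewrite big_mkord dist.
apply: eq_bigr => j _; rewrite /= comp_mpolyZ rmorphM /= !comp_mpolyXU.
rewrite -!tnth_nth mcoeffZ cE mulrzr !inord_val.
by case: eqP => //= ->; rewrite mulr0z.
Qed.

End Coefficients.


Section LowerBounds.

Variables (K : closedFieldType).
Hypothesis char_neq2 : 2%:R != 0 :> K.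

Lemma not_rank2 (m r j : nat) (G : r.-tuple {mpoly K[m]}) (a b c : 'I_r) :
  (j < 3)%N -> b != a ->
  (forall A : 'M[K]_r, A^T = A -> vanishes G (quadform A) ->
    [/\ A a a = 0, A a b = 0 & A a c *+ 2 + A b b = 0]) ->
  vanishes G ('X_a * 'X_c - 'X_b * 'X_b) ->
  ~ gen_in_rank (vanishes G) j.
Proof.
move=> j3 nba coefs van; apply: (@not_gen_in_rank _ _ _ _ b b _ van).
  rewrite mcoeffB -!mpolyXD !mcoeffX !mnm2_eq eqxx orbb (eq_sym a) (negPf nba).
  by rewrite sub0r oppr_eq0 oner_eq0.
move=> A symA rkA vA; rewrite eqxx; have [aa ab acbb] := coefs A symA vA.
exact: (isotropic2 symA (leq_trans rkA j3) aa ab acbb).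
Qed.

Lemma not_rank3 (m r j : nat) (G : r.-tuple {mpoly K[m]}) (a b c d : 'I_r) q :
  (j < 4)%N -> b != c ->
  (forall A : 'M[K]_r, A^T = A -> vanishes G (quadform A) ->
    [/\ A a a = 0, A a b = 0, A b b = 0, A a c = 0 & A a d + A b c = 0]) ->
  vanishes G q -> q@_(U_(b) + U_(c)) != 0 ->
  ~ gen_in_rank (vanishes G) j.
Proof.
move=> j4 nbc coefs van nz; apply: (@not_gen_in_rank _ _ _ _ b c _ van nz).
move=> A symA rkA vA; rewrite (negPf nbc); have [aa ab bb ac adbc] := coefs A symA vA.
have bc := isotropic3 symA (leq_trans rkA j4) aa ab bb ac adbc.
by rewrite -{2}symA mxE bc addr0.
Qed.

Definition toric_coefs (T : seq (seq nat)) (k l i j : nat) : int :=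
  if pair_sum T i j == pair_sum T k l then 1 else 0.

Lemma toric_coefsE (T : seq (seq nat)) m (k l i j : 'I_(size T)) :
  all (fun w => size w == m) T ->
  (tnth (toric K T m) i * tnth (toric K T m) j)@_(tmonom m k + tmonom m l) =
  (toric_coefs T k l i j)%:~R.
Proof.
move=> /allP sT; rewrite !tnth_mktuple -mpolyXD mcoeffX monom_sum_eq ?sT ?mem_nth //.
by rewrite /toric_coefs /pair_sum; case: eqP.
Qed.

Definition pent_coefs (k l i j : nat) : int :=
  let A := nth [::] pentagon in let B := nth [::] pentagon_tails in
  let w := sum_seq (A k) (A l) in
  (sum_seq (A i) (A j) == w)%:Z - (sum_seq (A i) (B j) == w)%:Z
    - (sum_seq (B i) (A j) == w)%:Z + (sum_seq (B i) (B j) == w)%:Z.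

Lemma pent_coefsE (k l i j : 'I_6) :
  (tnth (pent K) i * tnth (pent K) j)@_(pent_monom k + pent_monom l) =
  (pent_coefs k l i j)%:~R.
Proof.
have sA (a : 'I_6) : size (nth [::] pentagon a) == 3%N.
  by case: a => -[|[|[|[|[|[|a]]]]]].
have sB (a : 'I_6) : size (nth [::] pentagon_tails a) == 3%N.
  by case: a => -[|[|[|[|[|[|a]]]]]].
rewrite !tnth_mktuple mulrBl !mulrBr -!mpolyXD !mcoeffB !mcoeffX.
rewrite !monom_sum_eq ?sA ?sB // /pent_coefs !(rmorphD, rmorphN) /=.
by rewrite opprB addrA addrAC.
Qed.

Lemma add_self_eq0 (x : K) : x + x = 0 -> x = 0.
Proof. by move/eqP; rewrite -mulr2n -mulr_natr mulf_eq0 (negPf char_neq2) orbF => /eqP. Qed.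

Section Toric.

Variables (w0 : seq nat) (T' : seq (seq nat)) (m : nat).
Local Notation T := (w0 :: T').
Hypothesis size_T : all (fun w => size w == m) T.
Local Notation coefs k l := (cell_coefs (size T') (toric_coefs T k l)).

Lemma toric_entries (A : 'M[K]_(size T)) (k l : 'I_(size T)) s :
  vanishes (toric K T m) (quadform A) -> coefs k l = s ->
  \sum_(u <- s) A (inord u.1.1) (inord u.1.2) *~ u.2 = 0.
Proof.
move=> van <-; apply: (@quadform_coef_sum _ _ _ _ A (tmonom m k + tmonom m l)%MM _ van).
by move=> i j; exact: toric_coefsE.
Qed.

(** The list hypotheses enumerate all factorizations of the three relevant products into two
    monomials of the table. *)
Lemma toric_not_rank2 (j : nat) (a b c : 'I_(size T)) :
  (j < 3)%N -> b != a -> pair_sum T a c == pair_sum T b b ->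
  coefs a a = [:: (val a, val a, 1)] ->
  coefs a b = [:: (val a, val b, 1); (val b, val a, 1)] ->
  coefs b b = [:: (val a, val c, 1); (val b, val b, 1); (val c, val a, 1)] ->
  ~ gen_in_rank (vanishes (toric K T m)) j.
Proof.
move=> j3 nba acbb aa ab bb; apply: (@not_rank2 _ _ _ _ a b c j3 nba) => [A symA van|x].
  have sA i i' : A i i' = A i' i by rewrite -{1}symA mxE.
  have := toric_entries van bb; have := toric_entries van ab; have := toric_entries van aa.
  rewrite !big_cons !big_nil /= !inord_val !mulr1z !addr0 => -> ab0 bb0; split=> //.
    by apply: add_self_eq0; rewrite -[RHS]ab0 (sA b).
  by rewrite -[RHS]bb0 (sA c) mulr2n addrAC addrA.
by rewrite mevalB !mevalM !mevalXU (pair_sum_eval size_T x acbb) subrr.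
Qed.

Lemma toric_not_rank3 (j : nat) (a b c d : 'I_(size T)) :
  (j < 4)%N -> b != c -> b != a -> pair_sum T a d == pair_sum T b c ->
  coefs a a = [:: (val a, val a, 1)] ->
  coefs a b = [:: (val a, val b, 1); (val b, val a, 1)] ->
  coefs b b = [:: (val b, val b, 1)] ->
  coefs a c = [:: (val a, val c, 1); (val c, val a, 1)] ->
  coefs b c = [:: (val a, val d, 1); (val b, val c, 1);
                  (val c, val b, 1); (val d, val a, 1)] ->
  ~ gen_in_rank (vanishes (toric K T m)) j.
Proof.
move=> j4 nbc nba adbc aa ab bb ac bc.
apply: (@not_rank3 _ _ _ _ a b c d ('X_b * 'X_c - 'X_a * 'X_d) j4 nbc) => [A symA van|x|].
- have sA i i' : A i i' = A i' i by rewrite -{1}symA mxE.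
  have := toric_entries van bc; have := toric_entries van ac; have := toric_entries van bb.
  have := toric_entries van ab; have := toric_entries van aa.
  rewrite !big_cons !big_nil /= !inord_val !mulr1z !addr0 => -> ab0 -> ac0 bc0; split=> //.
  + by apply: add_self_eq0; rewrite -[RHS]ab0 (sA b).
  + by apply: add_self_eq0; rewrite -[RHS]ac0 (sA c).
  + apply: add_self_eq0; rewrite -[RHS]bc0 (sA c) (sA d); ring.
- by rewrite mevalB !mevalM !mevalXU (pair_sum_eval size_T x adbc) subrr.
rewrite mcoeffB -!mpolyXD !mcoeffX !mnm2_eq !eqxx (eq_sym a) (negPf nba) /=.
(* If [a = c], the lists in [aa] and [ac] would coincide, but their lengths are 1 and 2. *)
have [ac0|nac] := eqVneq a c; last by rewrite subr0 oner_eq0.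
have := congr1 size aa; rewrite {2}ac0 ac; discriminate.
Qed.

End Toric.

Lemma cubics_not_rank2 j : (j < 3)%N -> ~ gen_in_rank (vanishes (toric K cubics 3)) j.
Proof.
move=> j3; pose o i lt := @Ordinal 10 i lt.
by apply: (@toric_not_rank2 (head [::] cubics) (behead cubics)
    3 isT j (o 0%N isT) (o 3%N isT) (o 5%N isT)) => //; vm_compute.
Qed.

(** The indices 0, 3, 6 are consecutive points of an edge: [s_1^2 t_1^2], [s_0 s_1 t_1^2],
    [s_0^2 t_1^2]. *)
Lemma biquadrics_not_rank2 j :
  (j < 3)%N -> ~ gen_in_rank (vanishes (toric K biquadrics 4)) j.
Proof.
move=> j3; pose o i lt := @Ordinal 9 i lt.
by apply: (@toric_not_rank2 (head [::] biquadrics) (behead biquadrics)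
    4 isT j (o 0%N isT) (o 3%N isT) (o 6%N isT)) => //; vm_compute.
Qed.

(** The monomials [x^2 y], [x^2 z], [x y^2], [xyz] stand at positions [3 - t] to [6 - t]; with [x^3]
    dropped, the relevant products factor only as listed. *)
Lemma cubics_not_rank3 t j : (0 < t <= 3)%N -> (j < 4)%N ->
  ~ gen_in_rank (vanishes (toric K (drop t cubics) 3)) j.
Proof.
case: t => [|[|[|[|t]]]] // _ j4.
- pose o i lt := @Ordinal 9 i lt.
  by apply: (@toric_not_rank3 (head [::] (drop 1 cubics)) (behead (drop 1 cubics))
    3 isT j (o 2 isT) (o 3 isT) (o 4 isT) (o 5 isT)) => //; vm_compute.
- pose o i lt := @Ordinal 8 i lt.
  by apply: (@toric_not_rank3 (head [::] (drop 2 cubics)) (behead (drop 2 cubics))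
    3 isT j (o 1 isT) (o 2 isT) (o 3 isT) (o 4 isT)) => //; vm_compute.
- pose o i lt := @Ordinal 7 i lt.
  by apply: (@toric_not_rank3 (head [::] (drop 3 cubics)) (behead (drop 3 cubics))
    3 isT j (o 0 isT) (o 1 isT) (o 2 isT) (o 3 isT)) => //; vm_compute.
Qed.

Lemma pent_entries (A : 'M[K]_6) (k l : 'I_6) s :
  vanishes (pent K) (quadform A) -> cell_coefs 5 (pent_coefs k l) = s ->
  \sum_(u <- s) A (inord u.1.1) (inord u.1.2) *~ u.2 = 0.
Proof.
move=> van <-; apply: (@quadform_coef_sum _ _ _ _ A (pent_monom k + pent_monom l)%MM _ van).
by move=> i j; exact: pent_coefsE.
Qed.

Lemma pent_not_rank3 j : (j < 4)%N -> ~ gen_in_rank (vanishes (pent K)) j.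
Proof.
move=> j4; pose o i : 'I_6 := inord i.
(* This is the relation between [Q_2 x * Q_1 y] and [Q_1 x * Q_2 y]. *)
pose q : {mpoly K[6]} :=
  'X_(o 1%N) * 'X_(o 2) - 'X_(o 0%N) * 'X_(o 3) + 'X_(o 0%N) * 'X_(o 5).
apply: (@not_rank3 _ _ _ _ (o 0%N) (o 1%N) (o 2) (o 3) q j4) => [|A symA van|x|].
- by rewrite -val_eqE /= !inordK.
- have sA i i' : A i i' = A i' i by rewrite -{1}symA mxE.
  pose p i lt := @Ordinal 6 i lt.
  have e k l := @pent_entries A k l _ van erefl.
  have := e (p 0%N isT) (p 0%N isT); have := e (p 0%N isT) (p 1%N isT).
  have := e (p 1%N isT) (p 1%N isT); have := e (p 0%N isT) (p 2 isT).
  have := e (p 1%N isT) (p 2 isT).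
  (* The tails contribute multiples of [A a a] and [A a b], which vanish by the other
     coefficients. *)
  rewrite (_ : cell_coefs _ _ = [:: (0, 0, - 2%:Z); (0, 1, - 1%:Z); (0, 3, 1%:Z);
    (1, 0, - 1%:Z); (1, 2, 1%:Z); (2, 1, 1%:Z); (3, 0, 1%:Z)])%N; last by vm_compute.
  rewrite (_ : cell_coefs _ _ = [:: (0, 2, 1%:Z); (2, 0, 1%:Z)])%N; last by vm_compute.
  rewrite (_ : cell_coefs _ _ = [:: (1, 1, 1%:Z)])%N; last by vm_compute.
  rewrite (_ : cell_coefs _ _ = [:: (0, 1, 1%:Z); (1, 0, 1%:Z)])%N; last by vm_compute.
  rewrite (_ : cell_coefs _ _ = [:: (0, 0, 1%:Z)])%N; last by vm_compute.
  rewrite !big_cons !big_nil /= !mulrNz !mulr1z !addr0 -/(o 0%N) -/(o 1%N) -/(o 2) -/(o 3).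
  move=> bc ac bb ab aa.
  have ab0 : A (o 0%N) (o 1%N) = 0 by apply: add_self_eq0; rewrite -[RHS]ab (sA (o 1%N)).
  have ac0 : A (o 0%N) (o 2) = 0 by apply: add_self_eq0; rewrite -[RHS]ac (sA (o 2)).
  split=> //; apply: add_self_eq0; rewrite -[RHS]bc (sA (o 3)) (sA (o 2)) (sA (o 1%N) (o 0%N)).
  rewrite aa ab0 mul0rz; ring.
- rewrite !(mevalB, mevalD, mevalM, mevalXU) !pent_eval !inordK //=; ring.
- rewrite mcoeffD mcoeffB -!mpolyXD !mcoeffX !mnm2_eq -!val_eqE /= !inordK //=.
  by rewrite subr0 addr0 oner_eq0.
Qed.

End LowerBounds.

(** * Projective coordinates *)

Section Veronese.

Variables (K : closedFieldType) (n d : nat).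

Lemma prod_s2m (x : 'I_n.+1 -> K) (s : seq 'I_n.+1) :
  \prod_(i <- s) x i = \prod_i x i ^+ s2m s i.
Proof.
elim: s => [|j s IH].
  by rewrite big_nil big1 // => i _; rewrite mnmE expr0.
under [RHS]eq_bigr => i _.
  rewrite (_ : s2m (j :: s) i = (j == i) + s2m s i)%N ?exprD; last by rewrite !mnmE.
  over.
rewrite big_cons IH big_split; congr (_ * _).
rewrite (bigD1 j) //= big1 ?mulr1 ?eqxx ?expr1 // => i nij.
by rewrite eq_sym (negPf nij) expr0.
Qed.

Lemma veronese_monomial (k : 'X_{1..n.+1}) : mdeg k = d ->
  exists c : 'I_#|basis n.+1 d|, forall x : 'rV[K]_n.+1,
    veronese d x 0 c = ('X_[k] : {mpoly K[n.+1]}).@[x 0].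
Proof.
move=> /eqP; rewrite basis_cover => /imageP [t tb ->].
exists (enum_rank_in tb t) => x; rewrite mxE enum_rankK_in // mevalX.
exact: prod_s2m.
Qed.

Lemma veronese_homog (f : {mpoly K[n.+1]}) : f \is d.-homog ->
  exists C : 'cV[K]_#|basis n.+1 d|, forall x, (veronese d x *m C) 0 0 = f.@[x 0].
Proof.
move=> /dhomogP hf; rewrite [f]mpolyE.
elim: (msupp f) hf => [|k s IH] hf.
  by exists 0 => x; rewrite big_nil meval0 mulmx0 mxE.
have [|C CE] := IH; first by move=> k' k's; apply: hf; rewrite inE k's orbT.
have [|c cE] := @veronese_monomial k; first by apply: hf; exact: mem_head.
exists (f@_k *: delta_mx c 0 + C) => x; rewrite big_cons mevalD mevalZ -cE -CE.
by rewrite mulmxDr mxE -scalemxAr mxE -colE mxE.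
Qed.

Lemma veroneseZ c (x : 'rV[K]_n.+1) : veronese d (c *: x) = c ^+ d *: veronese d x.
Proof.
apply/rowP => k; rewrite !mxE; move: (enum_val k) => t.
under eq_bigr do rewrite mxE; rewrite big_split /=; congr (_ * _).
by rewrite big_const_seq count_predT size_tuple iter_mulr_1.
Qed.

End Veronese.

Lemma linsubst_homog (K : closedFieldType) (n d : nat) (h : 'M[K]_n) (f : {mpoly K[n]}) :
  f \is d.-homog -> linsubst h f \is d.-homog.
Proof.
move=> /dhomogP hf; rewrite [f]mpolyE /linsubst linear_sum big_seq.
apply: rpred_sum => k kf; rewrite linearZ rpredZ //= comp_mpolyX.
have /= <- := hf k kf; rewrite mdegE.
elim/big_rec2: _ => [|i p e _ he]; first by rewrite dhomog1.
apply: dhomogM => //; rewrite tnth_mktuple.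
have l1 : linform (row i h^T) \is 1.-homog.
  by apply: rpred_sum => j _; rewrite rpredZ // dhomogX /= mdeg1.
elim: (k i) => [|a IH]; first by rewrite expr0 dhomog1.
by rewrite exprS -add1n dhomogM.
Qed.

(** * Projective frames of the plane *)

Section Frames.

Variable K : closedFieldType.

Lemma row_free_snoc (n k : nat) (A : 'M[K]_(k, n)) (v : 'rV[K]_n) :
  row_free A -> ~~ (v <= A)%MS -> row_free (col_mx A v).
Proof.
move=> /eqP fA nv; rewrite /row_free eqn_leq rank_leq_row /= -addsmxE.
have lt : (A < A + v)%MS.
  by rewrite ltmxE addsmxSl /=; apply: contra nv; exact/submx_trans/addsmxSr.
by have := rank_ltmx lt; rewrite fA addn1.
Qed.

Lemma row_free_extend (n k : nat) (A : 'M[K]_(k, n)) :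
  row_free A -> (k < n)%N -> exists v : 'rV[K]_n, row_free (col_mx A v).
Proof.
move=> fA kn; have [/row_subP|/row_subPn [i ni]] := boolP ((1%:M : 'M[K]_n) <= A)%MS.
  move/row_subP/mxrankS; rewrite mxrank1 => le.
  by have := leq_trans le (rank_leq_row A); rewrite leqNgt kn.
by exists (row i 1%:M); exact: row_free_snoc.
Qed.

Definition frame (i : nat) : 'rV[K]_3 :=
  if (i < 3)%N then delta_mx 0 (inord i) else const_mx 1.

Lemma frame_matrix (v0 v1 v2 : 'rV[K]_3) : row_free (col_mx (col_mx v0 v1) v2) ->
  exists g h : 'M[K]_3, [/\ g *m h = 1%:M, v0 *m h = frame 0, v1 *m h = frame 1
    & v2 *m h = frame 2].
Proof.
move=> fR; pose R : 'M[K]_3 := col_mx (col_mx v0 v1) v2.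
have uR : R \in unitmx by rewrite -row_free_unit.
exists R, (invmx R); have E := mulmxV uR; split=> //.
all: move: E; rewrite {1}/R (mul_col_mx (m1 := 2) (m2 := 1)) (mul_col_mx (m1 := 1) (m2 := 1)).
all: set a := v0 *m _; set b := v1 *m _; set c := v2 *m _ => E.
- have := congr1 (row (lshift 1 (lshift 1 (0 : 'I_1)))) E.
  rewrite row1 (@rowKu _ 2 1) (@rowKu _ 1 1) => E1; rewrite -[a](row_id 0) E1 /frame /=.
  by congr delta_mx; apply: val_inj; rewrite /= inordK.
- have := congr1 (row (lshift 1 (rshift 1 (0 : 'I_1)))) E.
  rewrite row1 (@rowKu _ 2 1) (@rowKd _ 1 1) => E1; rewrite -[b](row_id 0) E1 /frame /=.
  by congr delta_mx; apply: val_inj; rewrite /= inordK.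
- have := congr1 (row (rshift 2 (0 : 'I_1))) E.
  rewrite row1 (@rowKd _ 2 1) => E1; rewrite -[c](row_id 0) E1 /frame /=.
  by congr delta_mx; apply: val_inj; rewrite /= inordK.
Qed.

End Frames.

Section GeneralPosition.

Variable K : closedFieldType.

Lemma row_free1 (v : 'rV[K]_3) : v != 0 -> row_free v.
Proof. by move=> v0; rewrite /row_free rank_rV v0. Qed.

Lemma row_free2 (v w : 'rV[K]_3) : v != 0 -> w != 0 -> ~~ (v == w)%MS ->
  row_free (col_mx v w).
Proof.
move=> v0 w0 nvw; apply: row_free_snoc; first exact: row_free1.
apply: contra nvw => wv; rewrite wv andbT.
by have := mxrank_leqif_eq wv; rewrite !rank_rV v0 w0 => -[_ /esym /eqmxP e]; rewrite e.
Qed.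

Lemma row_free3 (u v w : 'rV[K]_3) :
  (forall l : 'cV[K]_3, u *m l = 0 -> v *m l = 0 -> w *m l = 0 -> l = 0) ->
  row_free (col_mx (col_mx u v) w).
Proof.
move=> gen; pose R : 'M[K]_3 := col_mx (col_mx u v) w.
rewrite -[row_free _]/(row_free R) row_free_unit -unitmx_tr -row_free_unit.
apply: inj_row_free => l lR.
have : R *m l^T = 0 by rewrite -[R]trmxK -trmx_mul lR trmx0.
rewrite /R (mul_col_mx (m1 := 2) (m2 := 1)) (mul_col_mx (m1 := 1) (m2 := 1)).
move=> /(congr1 (fun M : 'M[K]_(1 + 1 + 1, 1) => (usubmx (usubmx M), dsubmx (usubmx M), dsubmx M))).
rewrite !col_mxKu !col_mxKd !raddf0 => -[ul vl wl].
by apply: trmx_inj; rewrite (gen _ ul vl wl) trmx0.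
Qed.

Definition framed (t : nat) (p : 'I_t -> 'rV[K]_3) (h : 'M[K]_3) :=
  forall i : 'I_t, exists c : K, p i *m h = c *: frame K i.

(** Up to three points extend to a basis, which is sent to the coordinate points. For [t = 4] a
    diagonal rescaling then moves the fourth point to (1:1:1). *)
Lemma general_frame (t : nat) (p : 'I_t -> 'rV[K]_3) : (t <= 4)%N -> linearly_general p ->
  exists g h : 'M[K]_3, g *m h = 1%:M /\ framed p h.
Proof.
move=> t4 [p0 p2 p3].
have done3 (q : nat -> 'rV[K]_3) : (t <= 3)%N -> (forall i : 'I_t, q i = p i) ->
    row_free (col_mx (col_mx (q 0%N) (q 1%N)) (q 2)) ->
    exists g h : 'M[K]_3, g *m h = 1%:M /\ framed p h.
  move=> t3 qp /frame_matrix [g [h [gh f0 f1 f2]]]; exists g, h; split=> // i.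
  exists 1; rewrite scale1r -qp; case: i => -[|[|[|i]]] //= it.
  by have := leq_trans it t3.
case: t t4 p p0 p2 p3 done3 => [|[|[|[|[|t]]]]] // _ p p0 p2 p3 done3.
- by exists 1%:M, 1%:M; rewrite mulmx1; split=> // -[].
- pose o := @Ordinal 1 0 isT; have f1 := row_free1 (p0 o).
  have [v f2] := row_free_extend f1 isT; have [w f3] := row_free_extend f2 isT.
  apply: (done3 (nth 0 [:: p o; v; w])) => // -[[|i] it] //=.
  by congr p; apply: val_inj.
- pose o := @Ordinal 2 0 isT; pose o' := @Ordinal 2 1 isT.
  have f2 := row_free2 (p0 o) (p0 o') (p2 o o' isT).
  have [w f3] := row_free_extend f2 isT.
  apply: (done3 (nth 0 [:: p o; p o'; w])) => // -[[|[|i]] it] //=;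
    by congr p; apply: val_inj.
- pose o i it := @Ordinal 3 i it.
  have f3 := row_free3 (p3 (o 0%N isT) (o 1%N isT) (o 2 isT) isT isT isT).
  apply: (done3 (nth 0 [:: p (o 0%N isT); p (o 1%N isT); p (o 2 isT)])) => //.
  by move=> -[[|[|[|i]]] it] //=; congr p; apply: val_inj.
pose o i it := @Ordinal 4 i it.
have f3 := row_free3 (p3 (o 0%N isT) (o 1%N isT) (o 2 isT) isT isT isT).
have [g [h [gh e0 e1 e2]]] := frame_matrix f3.
have hg : h *m g = 1%:M by exact: mulmx1C.
have [c cE] : exists c : 'rV[K]_3, p (o 3 isT) *m h = c by eexists.
(* A vanishing coordinate would put the fourth point on a side of the triangle. *)
have cn0 (i : 'I_3) (a b : 'I_4) : [&& a != b, a != o 3 isT & b != o 3 isT] ->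
    p a *m h = frame K a -> p b *m h = frame K b ->
    [&& (a < 3)%N, (b < 3)%N, val a != i & val b != i] -> c 0 i != 0.
  case/and3P => nab na nb ea eb /and4P [a3 b3 nai nbi].
  apply/negP => /eqP ci0; pose l : 'cV[K]_3 := h *m delta_mx i 0.
  have l0 (v : 'rV[K]_3) : (v *m h) 0 i = 0 -> v *m l = 0.
    by move=> vi; apply/matrixP => x y; rewrite !ord1 mulmxA -colE mxE vi mxE.
  have fr0 (j : 'I_4) : (j < 3)%N -> val j != i -> frame K j 0 i = 0.
    move=> j3 nji; rewrite /frame j3 mxE eqxx -val_eqE /= inordK //.
    by rewrite eq_sym (negPf nji).
  have : l = 0.
    by apply: (p3 a b (o 3 isT)) => //; apply: l0; rewrite ?ea ?eb ?cE ?fr0.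
  move=> /(congr1 (mulmx g)); rewrite mulmxA gh mul1mx mulmx0 => /matrixP/(_ i 0).
  by rewrite !mxE !eqxx => /eqP; rewrite oner_eq0.
have {}cn0 (i : 'I_3) : c 0 i != 0.
  case: i => -[|[|[|i]]] // it.
  - exact: (cn0 _ (o 1%N isT) (o 2 isT)).
  - exact: (cn0 _ (o 0%N isT) (o 2 isT)).
  - exact: (cn0 _ (o 0%N isT) (o 1%N isT)).
(* Scaling by the inverse coordinates of the fourth point keeps the coordinate points fixed up to
   scalars. *)
pose D := diag_mx (\row_i (c 0 i)^-1).
have cD : diag_mx c *m D = 1%:M.
  apply/matrixP => i j; rewrite mul_diag_mx !mxE.
  by case: eqP => [->|_]; rewrite ?mulr1n ?mulr0n ?mulr0 ?mulfV.
exists (diag_mx c *m g), (h *m D); split.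
  rewrite -mulmxA (mulmxA g) gh mul1mx.
  exact: cD.
have frD (k : nat) : (k < 3)%N -> frame K k *m D = (c 0 (inord k))^-1 *: frame K k.
  move=> k3; rewrite /frame k3 -rowE; apply/rowP => j; rewrite !mxE eqxx /=.
  by case: eqP => [->|/eqP nkj]; rewrite ?eqxx ?mulr1 // eq_sym (negPf nkj) mulr0.
case=> -[|[|[|[|i]]]] // it.
- exists (c 0 (inord 0))^-1; rewrite mulmxA -frD // -e0; congr (p _ *m _ *m _); exact: val_inj.
- exists (c 0 (inord 1))^-1; rewrite mulmxA -frD // -e1; congr (p _ *m _ *m _); exact: val_inj.
- exists (c 0 (inord 2))^-1; rewrite mulmxA -frD // -e2; congr (p _ *m _ *m _); exact: val_inj.
exists 1; rewrite scale1r mulmxA /frame /=.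
have -> : p (Ordinal it) = p (o 3 isT) by congr p; exact: val_inj.
by apply/rowP => j; rewrite cE mul_mx_diag !mxE mulfV.
Qed.

End GeneralPosition.

(** * The del Pezzo surfaces *)

Section Projection.

Variable K : closedFieldType.

Lemma vanishes_linform (m r : nat) (G : r.-tuple {mpoly K[m]}) (v : 'rV[K]_r) :
  vanishes G (linform v) <-> forall x, (param G x *m v^T) 0 0 = 0.
Proof.
rewrite vanishes_param; split=> v0 x; have := v0 x; rewrite linform_eval mxE => e;
  rewrite -[RHS]e; apply: eq_bigr => i _; by rewrite !mxE mulrC.
Qed.

Lemma param_homog (m r d : nat) (G : r.-tuple {mpoly K[m]}) c (x : 'rV[K]_m) :
  (forall j, tnth G j \is d.-homog) -> param G (c *: x) = c ^+ d *: param G x.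
Proof.
by move=> hG; apply/rowP => j; rewrite !mxE (homog_eval _ _ (hG j)).
Qed.

Lemma linear_projection_ideal (r : nat) (M : 'M[K]_(#|basis 3 3|, r)) x1 f :
  veronese 3 x1 *m M != 0 ->
  in_hideal (linear_projection (@veronese_plane K) M) f <->
  (forall x, f.@[(veronese 3 x *m M) 0] = 0).
Proof.
move=> Fx1; rewrite in_hideal_closure.
apply: (@in_hideal_param K 3 r 2 (fun x => veronese 3 x *m M)).
- by move=> c x; rewrite veroneseZ scalemxAl.
- move=> x Fx; split=> //; exists (veronese 3 x), 1.
  have Vx : veronese 3 x != 0 by apply: contra Fx => /eqP ->; rewrite mul0mx.
  split=> //; rewrite ?scale1r ?oner_eq0 //; split=> //; exists x, 1.
  have x0 : x != 0.
    apply: contra Vx => /eqP ->; rewrite -(scale0r (0 : 'rV[K]_3)) veroneseZ.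
    by rewrite expr0n scale0r.
  by split; rewrite ?scale1r ?oner_eq0.
- move=> y _ [_ [_ [c [_ [_ [x [c' [_ _ _ ->]]]] _ ->]]]].
  by exists (c * c'), x; rewrite -scalemxAl scalerA.
- by exists x1.
Qed.

(** After the coordinate change [h], the cubics [G] are linear forms on the Veronese space that
    vanish on the center. Their matrix [C] therefore factors through the projection [M], by an
    invertible matrix because the cubics are independent. *)
Lemma rank_index_projection (r k : nat) (G : r.-tuple {mpoly K[3]}) (s : nat)
    (p : 'I_s -> 'rV[K]_3) (M : 'M[K]_(#|basis 3 3|, r)) (g h : 'M[K]_3) x1 :
  projection_from (\matrix_(i < s) veronese 3 (p i)) M ->
  g *m h = 1%:M ->
  (forall j, tnth G j \is 3.-homog) ->
  (forall v : 'rV[K]_r, vanishes G (linform v) -> v = 0) ->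
  param G x1 != 0 ->
  (forall i, param G (p i *m h) = 0) ->
  gen_in_rank (vanishes G) k ->
  (forall j, (j < k)%N -> ~ gen_in_rank (vanishes G) j) ->
  rank_index (linear_projection (@veronese_plane K) M) k.
Proof.
move=> [/row_fullP [B BM] kerM] gh hG indG Gx1 Gp genk notgen.
have [C CE] : exists C : 'M[K]_(#|basis 3 3|, r),
    forall x, veronese 3 x *m C = param G (x *m h).
  have /fin_all_exists [C CE] : forall j, exists C : 'cV[K]_#|basis 3 3|,
      forall x, (veronese 3 x *m C) 0 0 = (tnth G j).@[(x *m h) 0].
    move=> j; have [C CE] := veronese_homog (linsubst_homog h (hG j)).
    by exists C => x; rewrite CE linsubst_eval.
  exists (\matrix_(a, j) C j a 0) => x; apply/rowP => j; rewrite [RHS]mxE -CE !mxE.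
  by apply: eq_bigr => a _; congr (_ * _); rewrite mxE.
have CMP : C = M *m (B *m C).
  apply/eqP; rewrite mulmxA -subr_eq0 -[X in X - _]mul1mx -mulmxBl; apply/eqP.
  (* The rows of [1 - M B] are killed by [M], hence lie in the span of the center, where [C] is
     zero. *)
  suff /submxP [D ->] : (1%:M - M *m B <= \matrix_(i < s) veronese 3 (p i))%MS.
    rewrite -mulmxA (_ : _ *m C = 0) ?mulmx0 //; apply/row_matrixP => i.
    by rewrite row_mul rowK CE Gp row0.
  by rewrite -kerM; apply/sub_kermxP; rewrite mulmxBl mul1mx -mulmxA BM mulmx1 subrr.
have FE x : veronese 3 x *m M *m (B *m C) = param G (x *m h).
  by rewrite -mulmxA -CMP.
have hg : h *m g = 1%:M by exact: mulmx1C.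
have uP : B *m C \in unitmx.
  rewrite -unitmx_tr -row_free_unit; apply: inj_row_free => v vP.
  apply: indG; apply/vanishes_linform => x.
  rewrite -[x]mulmx1 -gh mulmxA -FE -mulmxA.
  have -> : B *m C *m v^T = 0 by rewrite -[B *m C]trmxK -trmx_mul vP trmx0.
  by rewrite mulmx0 mxE.
have Fx1 : veronese 3 (x1 *m g) *m M != 0.
  apply: contra Gx1 => /eqP F0; have := FE (x1 *m g).
  by rewrite F0 mul0mx -mulmxA gh mulmx1 => <-.
apply: (rank_index_param (mulVmx uP) _ genk notgen) => f.
have FE' x : veronese 3 x *m M = param G (x *m h) *m invmx (B *m C).
  by rewrite -FE -mulmxA mulmxV // mulmx1.
rewrite (linear_projection_ideal _ Fx1); split=> f0 x; last by rewrite FE'.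
by rewrite -[x]mulmx1 -gh mulmxA -FE'.
Qed.

(** The variables have distinct leading monomials as images, so this is the degree one case of
    [leading_independent]. *)
Lemma linform_independent (m r : nat) (om : 'X_{1..m} -> nat)
    (A : 'I_r -> 'X_{1..m}) (G : r.-tuple {mpoly K[m]}) (v : 'rV[K]_r) :
  (forall a b, om (a + b)%MM = (om a + om b)%N) ->
  (forall j, leading om (A j) (tnth G j)) -> injective A ->
  vanishes G (linform v) -> v = 0.
Proof.
move=> omD leadG injA van.
have supp k : k \in msupp (linform v) -> exists j, k = U_(j)%MM.
  move=> /msupp_sum_le /flattenP [s /mapP [j _ ->] /msuppZ_le].
  by rewrite msuppX inE => /eqP ->; exists j.
have wU j : weight A U_(j)%MM = A j.
  apply/mnmP => i; rewrite weightE (bigD1 j) //= mnm1E eqxx muln1 big1 ?addn0 // => l nlj.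
  by rewrite mnm1E eq_sym (negPf nlj) muln0.
have f0 : linform v = 0.
  apply: (leading_independent omD leadG _ van) => k k' /supp [j ->] /supp [j' ->].
  by rewrite !wU => /injA ->.
apply/rowP => j; have := congr1 (mcoeff U_(j)%MM) f0.
rewrite mcoeff0 mxE /linform (big_morph _ (mcoeffD _) (mcoeff0 _ _)) (bigD1 j) //=.
rewrite big1 ?addr0 => [|i nij]; first by rewrite mcoeffZ mcoeffX eqxx mulr1.
rewrite mcoeffZ mcoeffX; case: eqP => [/mnmP/(_ i)|_]; last by rewrite mulr0.
by rewrite !mnm1E eqxx eq_sym (negPf nij).
Qed.

End Projection.

Section DelPezzo.

Variable K : closedFieldType.
Hypothesis char_neq2 : 2%:R != 0 :> K.

Lemma tmonom_inj (T : seq (seq nat)) m :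
  all (fun w => size w == m) T -> uniq T -> injective (@tmonom T m).
Proof.
move=> /allP sT uT i j E; apply: val_inj; apply/eqP.
rewrite -(nth_uniq [::] (ltn_ord i) (ltn_ord j) uT).
have sz (k : 'I_(size T)) : size (nth [::] T k) = m by apply/eqP/sT/mem_nth.
apply/eqP/(@eq_from_nth _ 0%N) => [|c]; rewrite !sz // => cm.
by have /mnmP/(_ (Ordinal cm)) := E; rewrite !mnmE.
Qed.

Lemma toric_independent (T : seq (seq nat)) m (v : 'rV[K]_(size T)) :
  all (fun w => size w == m) T -> uniq T -> vanishes (toric K T m) (linform v) -> v = 0.
Proof.
move=> sT uT; apply: (@linform_independent K m _ (fun=> 0%N) (@tmonom T m)) => //.
  by move=> j; rewrite tnth_mktuple => k; rewrite subrr mcoeff0 eqxx.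
exact: tmonom_inj.
Qed.

Lemma toric_homog (T : seq (seq nat)) m d (j : 'I_(size T)) :
  all (fun w => (size w == m) && (sumn w == d)) T -> tnth (toric K T m) j \is d.-homog.
Proof.
move=> /allP sT; have /andP [/eqP sj /eqP dj] := sT _ (mem_nth [::] (ltn_ord j)).
rewrite tnth_mktuple dhomogX /= mdegE -dj sumnE (big_nth 0%N) sj big_mkord.
by apply/eqP/eq_bigr => i _; rewrite mnmE.
Qed.

Lemma toric_ones (T : seq (seq nat)) m : (0 < size T)%N ->
  param (toric K T m) (const_mx 1) != 0.
Proof.
move=> T0; apply/eqP => /rowP/(_ (Ordinal T0)); rewrite !mxE tnth_mktuple mevalX.
by rewrite big1 => [/eqP|i _]; rewrite ?oner_eq0 // mxE expr1n.
Qed.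

Lemma toric_frame (T : seq (seq nat)) (i : nat) : (i < 3)%N ->
  all (fun w => has (fun l => (l != i) && (0 < nth 0%N w l)%N) (iota 0 3)) T ->
  param (toric K T 3) (frame K i) = 0.
Proof.
move=> i3 /allP avoid; apply/rowP => j; rewrite !mxE tnth_mktuple mevalX.
have /has_ord [l /andP [nli wl]] := avoid _ (mem_nth [::] (ltn_ord j)).
rewrite (bigD1 l) //= /frame i3 mxE mnmE eqxx -val_eqE /= inordK // (negPf nli) expr0n.
by rewrite eqn0Ngt wl mul0r.
Qed.

Lemma cubics_gen (t : nat) : (t <= 3)%N ->
  gen_in_rank (vanishes (toric K (drop t cubics) 3)) (if t == 0 then 3 else 4)%N.
Proof.
move=> t3; have uni := cubics_unimodular t3.
have sT : all (fun w => size w == 3%N) (drop t cubics).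
  by case: t t3 {uni} => [|[|[|[|]]]].
have [t0|_] := eqVneq t 0%N; last exact: (toric_gen4 sT char_neq2 uni).
by move: sT uni; rewrite t0 => sT uni; exact: (toric_gen3 sT char_neq2 uni cubics_rank3).
Qed.

Lemma cubics_not_gen (t j : nat) : (t <= 3)%N -> (j < if t == 0 then 3 else 4)%N ->
  ~ gen_in_rank (vanishes (toric K (drop t cubics) 3)) j.
Proof.
case: t => [_|t t3]; first exact: cubics_not_rank2.
exact: cubics_not_rank3.
Qed.

Lemma rank_index_toric (t : nat) (p : 'I_t -> 'rV[K]_3)
    (M : 'M[K]_(#|basis 3 3|, size (drop t cubics))) :
  (t <= 3)%N -> linearly_general p ->
  projection_from (\matrix_(i < t) veronese 3 (p i)) M ->
  rank_index (linear_projection (@veronese_plane K) M) (if t == 0 then 3 else 4)%N.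
Proof.
move=> t3 genp prM; have [g [h [gh fr]]] := general_frame (leqW t3) genp.
have sT : all (fun w => (size w == 3%N) && (sumn w == 3%N)) (drop t cubics).
  by case: t t3 {p M genp prM fr} => [|[|[|[|]]]].
have sT' : all (fun w => size w == 3%N) (drop t cubics).
  by apply: sub_all sT => w /andP[].
have hG j := @toric_homog _ 3 3 j sT.
apply: (rank_index_projection (x1 := const_mx 1) prM gh hG).
- by move=> v; apply: toric_independent => //; exact: drop_uniq.
- by apply: toric_ones; case: t t3 {p M genp prM fr sT sT' hG} => [|[|[|[|]]]].
- move=> i; have [c ->] := fr i; rewrite (param_homog _ _ hG).
  rewrite toric_frame ?scaler0 //; first exact: leq_trans (ltn_ord i) t3.
  case: t t3 p M genp prM fr sT sT' hG i => [|[|[|[|]]]] // _ p M _ _ _ _ _ _ [];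
    by move=> -[|[|[|]]].
- exact: cubics_gen.
- by move=> j; exact: cubics_not_gen.
Qed.

Lemma rank_index_pentagon (p : 'I_4 -> 'rV[K]_3) (M : 'M[K]_(#|basis 3 3|, 6)) :
  linearly_general p ->
  projection_from (\matrix_(i < 4) veronese 3 (p i)) M ->
  rank_index (linear_projection (@veronese_plane K) M) 4.
Proof.
move=> genp prM; have [g [h [gh fr]]] := general_frame (leqnn 4) genp.
have hG j : tnth (pent K) j \is 3.-homog.
  rewrite tnth_mktuple; apply: rpredB; rewrite dhomogX /= mdegE !big_ord_recl big_ord0 !mnmE.
    by case: j => -[|[|[|[|[|[|j]]]]]].
  by case: j => -[|[|[|[|[|[|j]]]]]].
(* At (1:-1:0) the first cubic [x^2 y - xyz] takes the value -1. *)
apply: (@rank_index_projection K 6 4 (pent K) 4 p M g h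
  (\row_i nth 0 [:: 1; - 1; 0] i) prM gh hG).
- move=> v; apply: (linform_independent pent_omD (@pent_leading K)).
  exact: (@tmonom_inj pentagon 3).
- apply/eqP => /rowP/(_ (inord 0)); rewrite !mxE pent_eval !inordK //= !mxE !inordK //=.
  by rewrite !mulr0 subr0 expr1n mul1r => /eqP; rewrite oppr_eq0 oner_eq0.
- move=> i; have [c ->] := fr i; rewrite (param_homog _ _ hG).
  suff -> : param (pent K) (frame K i) = 0 by rewrite scaler0.
  apply/rowP => j; rewrite !mxE pent_eval /frame.
  case: i => -[|[|[|[|i]]]] //= _; rewrite !mxE -?val_eqE /= ?inordK //=;
    case: j => -[|[|[|[|[|[|j]]]]]] //= _; ring.
- exact: pent_gen4.
- exact: pent_not_rank3.
Qed.

End DelPezzo.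

(** * The Veronese image of the quadric surface *)

Section QuadricSurface.

Variable K : closedFieldType.
Hypothesis char_neq2 : 2%:R != 0 :> K.

Local Notation u_ u k := ((u : 'rV[K]_4) 0 (inord k)).

(** The vector [u] packs the homogeneous coordinates [s_0, s_1, t_0, t_1] of a point of a product of
    two lines. *)
Definition segre (u : 'rV[K]_4) : 'rV[K]_4 :=
  \row_(i < 4) nth 0 [:: u_ u 0 * u_ u 2; u_ u 0 * u_ u 3; u_ u 1 * u_ u 2; u_ u 1 * u_ u 3] i.

Lemma segre_quadric u : ('X_(inord 0) * 'X_(inord 3) - 'X_(inord 1) * 'X_(inord 2)
  : {mpoly K[4]}).@[(segre u) 0] = 0.
Proof. rewrite mevalB !mevalM !mevalXU !mxE !inordK //=; ring. Qed.

(** A 2 by 2 matrix of determinant zero is a column times a row: the second row is a multiple of the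
    first, unless the first is zero. *)
Lemma segre_surj (x : 'rV[K]_4) : quadric_surface x -> exists u, x = segre u.
Proof.
case=> _; rewrite mevalB !mevalM !mevalXU => /eqP; rewrite subr_eq0 => /eqP E.
have ext (y : 'rV[K]_4) : u_ x 0 = u_ y 0 -> u_ x 1 = u_ y 1 -> u_ x 2 = u_ y 2 ->
    u_ x 3 = u_ y 3 -> x = y.
  move=> e0 e1 e2 e3; apply/rowP => i; rewrite -(inord_val i).
  by case: i => -[|[|[|[|i]]]].
have [x0|n0] := eqVneq (u_ x 0) 0; last first.
  exists (\row_i nth 0 [:: 1; u_ x 2 / u_ x 0; u_ x 0; u_ x 1] i).
  apply: ext; rewrite !mxE !inordK //= ?mxE ?inordK //= ?mul1r ?divfK //.
  by rewrite mulrAC [u_ x 2 * _]mulrC -E mulrAC mulfV ?mul1r.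
have [x1|n1] := eqVneq (u_ x 1) 0; last first.
  exists (\row_i nth 0 [:: 1; u_ x 3 / u_ x 1; u_ x 0; u_ x 1] i).
  apply: ext; rewrite !mxE !inordK //= ?mxE ?inordK //= ?mul1r ?divfK //.
  by rewrite mulrAC [u_ x 3 * _]mulrC E mulrAC mulfV ?mul1r.
exists (\row_i nth 0 [:: 0; 1; u_ x 2; u_ x 3] i).
by apply: ext; rewrite !mxE !inordK //= ?mxE ?inordK //= ?mul0r ?mul1r.
Qed.

Lemma biquadric_eval (u : 'rV[K]_4) (l : 'I_9) : let w := nth [::] biquadrics l in
  (tnth (toric K biquadrics 4) l).@[u 0] =
  u_ u 0 ^+ nth 0%N w 0 * u_ u 1 ^+ nth 0%N w 1 * u_ u 2 ^+ nth 0%N w 2 * u_ u 3 ^+ nth 0%N w 3.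
Proof.
rewrite /= tnth_mktuple mevalX -!mulrA !big_ord_recl big_ord0 !mnmE mulr1.
do 4 ?[congr (_ ^+ _ * _) | congr (_ ^+ _)]; by congr (u _ _); apply: val_inj; rewrite /= inordK.
Qed.

Lemma segre_product (i j : 'I_4) : exists l : 'I_9, forall u,
  segre u 0 i * segre u 0 j = (tnth (toric K biquadrics 4) l).@[u 0].
Proof.
(* Entry [3a + b] of [biquadrics] has degree [a] in [s_0] and [b] in [t_0]; [s_0] divides the Segre
   coordinates with index below 2, and [t_0] the even ones. *)
exists (inord (3 * ((i < 2) + (j < 2)) + (~~ odd i + ~~ odd j)))%N => u.
rewrite biquadric_eval !mxE; case: i j => -[|[|[|[|i]]]] //= _ -[[|[|[|[|j]]]]] //= _;
  rewrite inordK //= ?expr0 ?expr1; ring.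
Qed.

Lemma veronese_segre : exists D : 'M[K]_(9, #|basis 4 2|),
  forall u, veronese 2 (segre u) = param (toric K biquadrics 4) u *m D.
Proof.
have /fin_all_exists [l lE] : forall k : 'I_#|basis 4 2|, exists l : 'I_9, forall u,
    veronese 2 (segre u) 0 k = (tnth (toric K biquadrics 4) l).@[u 0].
  move=> k; pose s : 2.-tuple 'I_4 := enum_val k.
  have [l lE] := segre_product (tnth s 0) (tnth s 1).
  exists l => u; rewrite -lE mxE -/s [tval s](_ : _ = [:: tnth s 0; tnth s 1]).
    by rewrite big_cons big_seq1.
  case: s {lE} => -[|a [|b [|c s]]] //= sz; rewrite !(tnth_nth a) /=; congr [:: _; _].
exists (\matrix_(a, k) (a == l k)%:R) => u; apply/rowP => k; rewrite lE mxE.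
rewrite (bigD1 (l k)) //= big1 ?addr0 => [|a nal]; rewrite [X in _ * X]mxE ?eqxx ?mulr1 ?mxE //.
by rewrite (negPf nal) mulr0.
Qed.

(** The points lie in the row space of [D], so [B = P D]. As [B] has rank 9, the square matrix [P]
    is invertible, and the coordinates in the span are those of the biquadric parametrization up to
    [P]. *)
Lemma rank_index_quadric (B : 'M[K]_(9, #|basis 4 2|)) :
  basis_of_span (@veronese_quadric K) B ->
  rank_index (in_span (@veronese_quadric K) B) 3.
Proof.
case=> freeB spanB; have [D DE] := veronese_segre.
pose G := toric K biquadrics 4.
have XD y : veronese_quadric y -> exists c u, y = c *: (param G u *m D).
  by case=> _ [x [c [_ /segre_surj [u ->] _ ->]]]; exists c, u; rewrite DE.
have /submxP [P BE] : (B <= D)%MS.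
  rewrite -(genmxE D); apply/spanB => y /XD [c [u ->]].
  by rewrite genmxE scalemx_sub ?submxMl.
have uP : P \in unitmx.
  rewrite -row_free_unit /row_free eqn_leq rank_leq_row /=.
  by rewrite -{1}(eqP freeB) BE mxrankM_maxl.
have [B' BB'] := row_freeP freeB.
have FB u : param G u *m invmx P *m B = veronese 2 (segre u).
  by rewrite BE -mulmxA mulKmx // DE.
have hG j : tnth G j \is 4.-homog by apply: toric_homog.
apply: (@rank_index_param K 4 9 3 G _ (invmx P) P (mulVmx uP)) => [f||j].
- apply: (@in_hideal_param K 4 9 3 (fun u => param G u *m invmx P)).
  + by move=> c u; rewrite (param_homog _ _ hG) scalemxAl.
  + move=> u Fu; split=> //; rewrite FB.
    have V0 : veronese 2 (segre u) != 0.
      apply: contra Fu => /eqP V0; have := FB u; rewrite V0 => /(congr1 (mulmx^~ B')) /=.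
      by rewrite mul0mx -(mulmxA _ B B') BB' mulmx1 => ->.
    have s0 : segre u != 0.
      apply: contra V0 => /eqP ->; rewrite -(scale0r (0 : 'rV[K]_4)) veroneseZ.
      by rewrite expr0n scale0r.
    split=> //; exists (segre u), 1; split; rewrite ?scale1r ?oner_eq0 //.
    by split=> //; exact: segre_quadric.
  + move=> y _ [_ /XD [c [u yB]]]; exists c, u.
    rewrite -[y]mulmx1 -BB' mulmxA yB -DE -FB.
    by rewrite -scalemxAl -(mulmxA _ B B') BB' mulmx1.
  + exists (const_mx 1); apply/eqP => F0.
    have /eqP := @toric_ones K biquadrics 4 isT; apply.
    by rewrite -[LHS]mulmx1 -(mulVmx uP) mulmxA F0 mul0mx.
- exact: (@toric_gen3 K biquadrics _ 4 isT char_neq2 biquadrics_unimodular biquadrics_rank3).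
- exact: biquadrics_not_rank2.
Qed.

End QuadricSurface.

Theorem theorem6p1 (K : closedFieldType) (char_neq2 : 2%:R != 0 :> K) :
  (forall (t : nat) (p : 'I_t -> 'rV[K]_3)
          (M : 'M[K]_(#|basis 3 3|, 10 - t)),
     (t <= 4)%N ->
     linearly_general p ->
     projection_from (\matrix_(i < t) veronese 3 (p i)) M ->
     rank_index (linear_projection (@veronese_plane K) M)
                (if t == 0 then 3 else 4)%N)
  /\
  (forall B : 'M[K]_(9, #|basis 4 2|),
     basis_of_span (@veronese_quadric K) B ->
     rank_index (in_span (@veronese_quadric K) B) 3).
Proof.
split; last exact: rank_index_quadric.
case=> [|[|[|[|[|t]]]]] // p M _.
- exact: (@rank_index_toric K char_neq2 0 p M isT).
- exact: (@rank_index_toric K char_neq2 1 p M isT).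
- exact: (@rank_index_toric K char_neq2 2 p M isT).
- exact: (@rank_index_toric K char_neq2 3 p M isT).
- exact: rank_index_pentagon.
Qed.
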